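(* Let $\alpha,\beta,\gamma\in\mathbb{C}$ satisfy $\Re(2\gamma-\alpha-\beta)<1$ and $\frac{\alpha+1}{2},\frac{\beta+1}{2},\gamma+1\notin\mathbb{Z}_{\le 0}$. Then $$\mathrm{CF}\left[\Delta\bigl(n(n+\alpha)(n+\beta)\bigr),\,-2n(n+\alpha)(n+\beta)(n+\gamma)\right]=4\left\{\sum_{n=0}^\infty \frac{\bigl(\frac12\bigr)_n(\gamma+1)_n}{\bigl(\frac{\alpha+1}{2}\bigr)_{n+1}\bigl(\frac{\beta+1}{2}\bigr)_{n+1}}\right\}^{-1}.$$
   Context: For sequences $(a_n)_{n\ge0}$, $(b_n)_{n\ge1}$ of complex numbers, $\mathrm{CF}[a_n,b_n]$ denotes the continued fraction $a_0+\cfrac{b_1}{a_1+\cfrac{b_2}{a_2+\ddots}}$, whose value is $\lim_{n\to\infty}A_n/B_n$, where $A_0=1$, $A_1=a_0$, $B_0=0$, $B_1=1$, and $A_{n+1}=a_nA_n+b_nA_{n-1}$, $B_{n+1}=a_nB_n+b_nB_{n-1}$ for $n\ge1$. The limit is taken in $\mathbb{C}\cup\{\infty\}$, with the convention $0^{-1}=\infty$. The difference operator $\Delta$ acts in the variable $n$ by $\Delta f(n)=f(n+1)-f(n)$, so $\Delta(n(n+\alpha)(n+\beta))=(n+1)(n+1+\alpha)(n+1+\beta)-n(n+\alpha)(n+\beta)$. $(x)_n=x(x+1)\cdots(x+n-1)$, $(x)_0=1$, is the Pochhammer symbol. *)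

(* Defs.v *)
From Stdlib Require Import Reals.
From Coquelicot Require Import Coquelicot.

Open Scope C_scope.

(** The Riemann sphere. *)
Inductive Cbar : Set :=
  | Cfinite : C -> Cbar
  | Cinfty : Cbar.

(** The neighbourhoods of [Cinfty] are the sets containing it and the exterior
    of some disc. *)
Definition Cbar_locally (l : Cbar) (P : Cbar -> Prop) : Prop :=
  match l with
  | Cfinite z => locally z (fun w : C => P (Cfinite w))
  | Cinfty => P Cinfty /\
      exists M : R, forall w : C, (M < Cmod w)%R -> P (Cfinite w)
  end.

(** Only meaningful when [x] and [y] are not both [0]. *)
Definition Cbar_div (x y : C) : Cbar :=
  if Ceq_dec y 0 then Cinfty else Cfinite (x / y).

(** With this indexing the [n]-th convergent is
    [a 0 + b 1 / (a 1 + ... + b (n - 1) / a (n - 1))]; [b 0] is never used. *)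
Fixpoint CF_num (a b : nat -> C) (n : nat) : C :=
  match n with
  | O => 1
  | S O => a O
  | S (S k as m) => a m * CF_num a b m + b m * CF_num a b k
  end.

Fixpoint CF_den (a b : nat -> C) (n : nat) : C :=
  match n with
  | O => 0
  | S O => 1
  | S (S k as m) => a m * CF_den a b m + b m * CF_den a b k
  end.

(** [CF[a_n, b_n] = l]. If some [b n] vanishes, a convergent may be [0 / 0];
    this is allowed for finitely many [n] only, so that the junk value of
    [Cbar_div 0 0] does not influence the limit. *)
Definition is_CF (a b : nat -> C) (l : Cbar) : Prop :=
  eventually (fun n => CF_num a b n <> 0 \/ CF_den a b n <> 0) /\
  filterlim (fun n => Cbar_div (CF_num a b n) (CF_den a b n))
    eventually (Cbar_locally l).

Definition INC (n : nat) : C := RtoC (INR n).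

Definition fwd_diff (f : nat -> C) (n : nat) : C := f (S n) - f n.

Fixpoint pochhammer (x : C) (n : nat) : C :=
  match n with
  | O => 1
  | S m => pochhammer x m * (x + INC m)
  end.

Definition nonpos_integer (z : C) : Prop := exists k : nat, z = - INC k.

(* Main.v *)
(* Write [a_n], [b_n] for the coefficients of the continued fraction and [u_k] for the terms
   of the series, with sum [S]. Expand
     (1 - sqrt (1-v))^n / sqrt (1-v) = sum_k q(n,k) v^k,    rho(n,k) = q(n,k) / q(0,k).
   Then [M_n = (alpha+1)_n (beta+1)_n sum_k rho(n,k) u_k] satisfies the recurrence of the
   continued fraction, by telescoping in [k], and [M_0 = S], [M_1 = a_0 S - 4]; hence
   [M_n = S A_n - 4 B_n]. Since [0 <= rho <= 1], this remainder is at most a constant times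
   [|(alpha+1)_n (beta+1)_n|], so it grows like [n!^2] up to a polynomial factor, whereas after
   division by [n!^2] the recurrence has the characteristic roots 1 and 2. If no [b_n] vanishes,
   the Casoratian of [A] and [M] forces [A_n] to grow like [2^n n!^2], so [B_n / A_n] tends to
   [S / 4]. If some [b_n] vanishes, so does [(alpha+1)_n (beta+1)_n], hence [M_n], from there
   on; and [A_n] is eventually a nonzero multiple of the numerator of a continued fraction with
   shifted parameters, to which the first case applies after at most two shifts. *)
Require Import Defs.
From Stdlib Require Import Reals Lra Lia Factorial.
From Coquelicot Require Import Coquelicot.
Open Scope C_scope.

(** * Series *)

(** Balls of the uniform structure on [C] are squares, being products of real intervals; the
    norm-ball criterion trades them for discs. *)
Lemma Cfilterlim_Cmod (f : nat -> C) (l : C) :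
  filterlim f eventually (locally (T := C_UniformSpace) l) <->
  forall eps : R, (0 < eps)%R ->
    eventually (fun n => (Cmod (f n - l) < eps)%R).
Proof.
  split.
  - intros H eps Heps.
    exact (proj1 (filterlim_locally_ball_norm (U := C_NormedModule) f l)
             H (mkposreal eps Heps)).
  - intros H. apply (proj2 (filterlim_locally_ball_norm (U := C_NormedModule) f l)).
    intros eps. exact (H eps (cond_pos eps)).
Qed.

Lemma Cis_series_Cmod (a : nat -> C) (l : C) :
  is_series a l <->
  forall eps : R, (0 < eps)%R ->
    eventually (fun n => (Cmod (sum_n a n - l) < eps)%R).
Proof. exact (Cfilterlim_Cmod (sum_n a) l). Qed.

Lemma Cmod_sum_n_le (a : nat -> C) (n : nat) :
  (Cmod (sum_n a n) <= sum_n (fun k => Cmod (a k)) n)%R.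
Proof.
  apply (norm_sum_n_m (V := C_NormedModule) a 0 n).
Qed.

Lemma fst_sum_n (a : nat -> C) (n : nat) :
  fst (sum_n a n) = sum_n (fun k => fst (a k)) n.
Proof.
  induction n as [|n IH]; [now rewrite !sum_O|].
  rewrite !sum_Sn, <- IH. reflexivity.
Qed.

Lemma snd_sum_n (a : nat -> C) (n : nat) :
  snd (sum_n a n) = sum_n (fun k => snd (a k)) n.
Proof.
  induction n as [|n IH]; [now rewrite !sum_O|].
  rewrite !sum_Sn, <- IH. reflexivity.
Qed.

Lemma Cex_series_abs (a : nat -> C) :
  ex_series (fun k => Cmod (a k)) -> exists l : C, is_series a l.
Proof.
  intros Ha.
  destruct (ex_series_le (V := R_CompleteNormedModule) (fun k => fst (a k))
    (fun k => Cmod (a k))) as [x Hx]; [|exact Ha|].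
  { intros n. apply (Rle_trans _ _ _ (Rmax_l _ _) (Rmax_Cmod (a n))). }
  destruct (ex_series_le (V := R_CompleteNormedModule) (fun k => snd (a k))
    (fun k => Cmod (a k))) as [y Hy]; [|exact Ha|].
  { intros n. apply (Rle_trans _ _ _ (Rmax_r _ _) (Rmax_Cmod (a n))). }
  exists (x, y).
  apply (proj2 (filterlim_locally (U := C_UniformSpace) (sum_n a) (x, y))).
  intros eps.
  generalize (filter_and _ _ (proj1 (filterlim_locally _ _) Hx eps)
    (proj1 (filterlim_locally _ _) Hy eps)).
  apply filter_imp. intros n [H1 H2]. split.
  - rewrite fst_sum_n. exact H1.
  - rewrite snd_sum_n. exact H2.
Qed.

Lemma Cmod_is_series_le (a : nat -> C) (l : C) (T : R) :
  is_series a l -> (forall n, (sum_n (fun k => Cmod (a k)) n <= T)%R) ->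
  (Cmod l <= T)%R.
Proof.
  intros Hl HT. apply Rle_plus_epsilon. intros eps Heps.
  destruct (proj1 (Cis_series_Cmod _ _) Hl eps Heps) as [N HN].
  specialize (HN N (Nat.le_refl N)).
  assert (H1 := Cmod_triangle (sum_n a N) (l - sum_n a N)).
  replace (sum_n a N + (l - sum_n a N)) with l in H1 by ring.
  assert (H2 := Cmod_sum_n_le a N). specialize (HT N).
  replace (l - sum_n a N) with (- (sum_n a N - l)) in H1 by ring.
  rewrite Cmod_opp in H1. lra.
Qed.

(** Raabe's test in summation form: eta v_k <= (k-1) v_k - k v_{k+1}, and the right side telescopes,
    so the partial sums are bounded. The second conclusion is Olivier's theorem for decreasing
    summable sequences; it later removes the boundary term of a telescoping sum. *)
Lemma raabe (v : nat -> R) (eta : R) (N : nat) :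
  (0 < eta)%R -> (forall k, (0 <= v k)%R) ->
  (forall k, (N <= k)%nat -> (INR k * v (S k) <= (INR k - 1 - eta) * v k)%R) ->
  ex_series v /\ is_lim_seq (fun k => (INR k * v (S k))%R) 0%R.
Proof.
  intros Heta Hv H.
  set (M := (S N)).
  assert (Hs : forall n, (eta * sum_n (fun k => v (M + k)%nat) n
      <= INR (M - 1) * v M - INR (M + n) * v (S (M + n)))%R).
  { induction n as [|n IH].
    - rewrite sum_O. replace (M + 0)%nat with M by lia.
      unfold M. replace (S N - 1)%nat with N by lia.
      specialize (H (S N)). rewrite S_INR in *.
      assert (N <= S N)%nat by lia. specialize (H H0). lra.
    - rewrite sum_Sn. change (plus ?x ?y) with (x + y)%R.
      specialize (H (M + S n)%nat ltac:(unfold M; lia)).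
      replace (S (M + n)) with (M + S n)%nat in IH by lia.
      replace (INR (M + n)) with (INR (M + S n) - 1)%R in IH
        by (rewrite <- plus_n_Sm, S_INR; ring).
      lra. }
  assert (Hex : ex_series v).
  { apply (ex_series_incr_n v M).
    destruct (ex_finite_lim_seq_incr (sum_n (fun k => v (M + k)%nat))
      (INR (M - 1) * v M / eta)) as [l Hl].
    - intros n. rewrite sum_Sn. change (plus ?x ?y) with (x + y)%R.
      specialize (Hv (M + S n)%nat). lra.
    - intros n. apply Rmult_le_reg_l with eta; [lra|].
      replace (eta * (INR (M - 1) * v M / eta))%R with (INR (M - 1) * v M)%R by (field; lra).
      specialize (Hs n).
      assert (0 <= INR (M + n) * v (S (M + n)))%R
        by (apply Rmult_le_pos; [apply pos_INR | apply Hv]).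
      lra.
    - exists l. exact Hl. }
  split; [exact Hex|].
  assert (Hdec : forall j k, (M <= j)%nat -> (j <= k)%nat -> (v k <= v j)%R).
  { intros j k Hj Hk. induction Hk as [|k Hk IH]; [lra|].
    apply Rle_trans with (v k); [|exact IH].
    specialize (H k ltac:(unfold M in *; lia)). specialize (Hv k).
    assert (0 < INR k)%R by (apply lt_0_INR; unfold M in *; lia).
    apply Rmult_le_reg_l with (INR k); [assumption|]. nra. }
  assert (Hblock : forall h d c, (forall j, (h <= j <= h + d)%nat -> (c <= v j)%R) ->
    (INR (S d) * c <= sum_n_m v h (h + d))%R).
  { intros h d c. induction d as [|d IH]; intros Hc.
    - replace (h + 0)%nat with h by lia. rewrite sum_n_n.
      specialize (Hc h ltac:(lia)). simpl. lra.
    - replace (h + S d)%nat with (S (h + d)) by lia.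
      rewrite sum_n_Sm by lia. change (plus ?x ?y) with (x + y)%R.
      specialize (IH ltac:(intros j Hj; apply Hc; lia)).
      specialize (Hc (S (h + d)) ltac:(lia)).
      rewrite (S_INR (S d)). lra. }
  apply is_lim_seq_spec. intros eps.
  (* The block of indices from h = K/2 to K has at least K/2 terms, each at least v_{K+1}, so K
     v_{K+1} is at most twice a Cauchy block. *)
  destruct (Cauchy_ex_series v Hex (pos_div_2 eps)) as [N' HN'].
  exists (2 * (N' + M))%nat. intros K HK. rewrite Rminus_0_r.
  assert (Hh := Nat.div_mod_eq K 2). assert (Hr := Nat.mod_upper_bound K 2 ltac:(lia)).
  set (h := Nat.div K 2) in *. set (r := Nat.modulo K 2) in *.
  specialize (HN' h K ltac:(lia) ltac:(lia)).
  replace K with (h + (K - h))%nat in HN' by lia.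
  assert (Hb := Hblock h (K - h)%nat (v (S K))
    ltac:(intros j Hj; apply Hdec; lia)).
  assert (HK2 : (INR K <= 2 * INR (S (K - h)))%R).
  { change 2%R with (INR 2). rewrite <- mult_INR. apply le_INR. lia. }
  assert (Hn := Rle_abs (sum_n_m v h (h + (K - h)))).
  change (norm (sum_n_m v h (h + (K - h)))) with (Rabs (sum_n_m v h (h + (K - h)))) in HN'.
  simpl in HN'. specialize (Hv (S K)).
  rewrite Rabs_pos_eq by (apply Rmult_le_pos; [apply pos_INR | assumption]).
  nra.
Qed.
(** * The terms of the series *)

Lemma eventually_INR_ge (x : R) : eventually (fun n => (x <= INR n)%R).
Proof.
  destruct (INR_unbounded x) as [N HN]. exists N. intros n Hn.
  apply le_INR in Hn. lra.
Qed.

Lemma INC_S (n : nat) : INC (S n) = INC n + 1.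
Proof. unfold INC. now rewrite S_INR, RtoC_plus. Qed.

Lemma Cmod_INC_plus_ge (z : C) (k : nat) : (INR k + Re z <= Cmod (INC k + z))%R.
Proof.
  eapply Rle_trans; [|apply re_le_Cmod]. eapply Rle_trans; [|apply Rle_abs].
  unfold INC, Re. simpl. lra.
Qed.

(** After squaring, what is left is (Im z)^2 <= 2 e (k + Re z) + e^2, true for large k. The triangle
    inequality would put |z| in place of Re z and lose the sharp condition on Re (2 gamma - alpha -
    beta). *)
Lemma Cmod_INC_plus_le (z : C) (e : R) : (0 < e)%R ->
  eventually (fun k => (Cmod (INC k + z) <= INR k + Re z + e)%R).
Proof.
  intros He. generalize (eventually_INR_ge (Rabs (Re z) + (Im z)² / e)).
  apply filter_imp. intros k Hk.
  assert (H1 := Rle_abs (- Re z)). rewrite Rabs_Ropp in H1.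
  assert (H2 : (0 <= (Im z)² / e)%R)
    by (apply Rmult_le_pos; [apply Rle_0_sqr | apply Rlt_le, Rinv_0_lt_compat, He]).
  assert (H3 : ((Im z)² = (Im z)² / e * e)%R) by (field; lra).
  unfold Cmod, INC. rewrite <- (sqrt_Rsqr (INR k + Re z + e)) by lra.
  apply sqrt_le_1_alt. simpl. rewrite Rplus_0_l.
  change (fst z) with (Re z). change (snd z) with (Im z). unfold Rsqr in *. nra.
Qed.

Definition term (alpha beta gamma : C) (n : nat) : C :=
  pochhammer (1 / 2) n * pochhammer (gamma + 1) n /
  (pochhammer ((alpha + 1) / 2) (n + 1) * pochhammer ((beta + 1) / 2) (n + 1)).

Lemma pochhammer_neq_0 (x : C) (n : nat) :
  ~ nonpos_integer x -> pochhammer x n <> 0.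
Proof.
  intros Hx. induction n as [|n IH]; simpl; [apply C1_nz|].
  apply Cmult_neq_0; [exact IH|]. intros H. apply Hx. exists n.
  replace x with (x + INC n - INC n) by ring. rewrite H. ring.
Qed.

Lemma nonpos_integer_factor (x : C) (n : nat) :
  ~ nonpos_integer x -> x + INC n <> 0.
Proof.
  intros Hx H. apply Hx. exists n.
  replace x with (x + INC n - INC n) by ring. rewrite H. ring.
Qed.

Lemma term_S (alpha beta gamma : C) (k : nat) :
  ~ nonpos_integer ((alpha + 1) / 2) -> ~ nonpos_integer ((beta + 1) / 2) ->
  term alpha beta gamma (S k) *
    (INC k + ((alpha + 1) / 2 + 1)) * (INC k + ((beta + 1) / 2 + 1)) =
  term alpha beta gamma k * (INC k + 1 / 2) * (INC k + (gamma + 1)).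
Proof.
  intros Ha Hb. unfold term. rewrite !Nat.add_1_r. simpl pochhammer.
  assert (H1 := pochhammer_neq_0 _ k Ha). assert (H2 := pochhammer_neq_0 _ k Hb).
  assert (H3 := nonpos_integer_factor _ k Ha). assert (H4 := nonpos_integer_factor _ k Hb).
  assert (H5 := nonpos_integer_factor _ (S k) Ha).
  assert (H6 := nonpos_integer_factor _ (S k) Hb).
  rewrite INC_S in *.
  set (c := (alpha + 1) / 2) in *. set (d := (beta + 1) / 2) in *.
  set (h := 1 / 2) in *. set (i := INC k) in *.
  set (p1 := pochhammer c k) in *. set (p2 := pochhammer d k) in *.
  field. repeat split; assumption.
Qed.

(** The ratio |u_{k+1} / u_k| behaves like 1 - (1 + tau/2) / k, which leaves room for Raabe's
    test. *)
Lemma term_raabe (alpha beta gamma : C) :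
  (Re (2 * gamma - alpha - beta) < 1)%R ->
  ~ nonpos_integer ((alpha + 1) / 2) -> ~ nonpos_integer ((beta + 1) / 2) ->
  ex_series (fun k => Cmod (term alpha beta gamma k)) /\
  is_lim_seq (fun k => (INR k * Cmod (term alpha beta gamma (S k)))%R) 0%R.
Proof.
  intros Hre Ha Hb.
  set (tau := (1 - Re (2 * gamma - alpha - beta))%R).
  (* One [e] is spent on the bound of |k + gamma + 1| and one as Raabe's exponent; of the margin
     tau/2 there remains tau/4. *)
  set (e := (tau / 8)%R).
  assert (Htau : (0 < tau)%R) by (unfold tau; lra).
  assert (He : (0 < e)%R) by (unfold e; lra).
  set (c := Re ((alpha + 1) / 2 + 1)). set (d := Re ((beta + 1) / 2 + 1)).
  set (g := Re (gamma + 1)).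
  assert (Hcd : (c + d - g - 3 / 2 = tau / 2)%R).
  { unfold c, d, g, tau. destruct alpha, beta, gamma. simpl. field. }
  (* In [Hpoly] the cubic terms cancel; [B] and [- F] are the linear and constant coefficients of
     the remaining quadratic, and its leading coefficient tau/4 dominates them for large k. *)
  set (B := (c * d - (1 + e) * (c + d) - (g + e) / 2)%R).
  set (F := ((1 + e) * (c * d))%R).
  assert (Hev : eventually (fun k =>
    (Cmod (INC k + (gamma + 1)) <= INR k + g + e)%R /\
    (Rabs c + 1 <= INR k)%R /\ (Rabs d + 1 <= INR k)%R /\
    (1 + e <= INR k)%R /\ ((Rabs B + Rabs F) / (tau / 4) + 1 <= INR k)%R)).
  { apply filter_and; [apply Cmod_INC_plus_le, He|].
    repeat (apply filter_and; [apply eventually_INR_ge|]). apply eventually_INR_ge. }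
  destruct Hev as [N HN].
  apply (raabe (fun k => Cmod (term alpha beta gamma k)) e N He); [intros k; apply Cmod_ge_0|].
  intros k Hk. destruct (HN k Hk) as [H1 [H2 [H3 [H4 H5]]]].
  assert (Hc := Rle_abs (- c)). assert (Hd := Rle_abs (- d)).
  rewrite Rabs_Ropp in Hc, Hd.
  assert (Hk1 : (1 <= INR k)%R) by (assert (H := Rabs_pos c); lra).
  assert (Heq := f_equal Cmod (term_S alpha beta gamma k Ha Hb)).
  rewrite !Cmod_mult in Heq.
  assert (G1 := Cmod_INC_plus_ge ((alpha + 1) / 2 + 1) k). fold c in G1.
  assert (G2 := Cmod_INC_plus_ge ((beta + 1) / 2 + 1) k). fold d in G2.
  assert (G3 : Cmod (INC k + 1 / 2) = (INR k + 1 / 2)%R).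
  { unfold INC. rewrite <- RtoC_div, <- RtoC_plus by lra.
    rewrite Cmod_R, Rabs_pos_eq; [reflexivity|lra]. }
  rewrite G3 in Heq.
  assert (V := Cmod_ge_0 (term alpha beta gamma k)).
  assert (V' := Cmod_ge_0 (term alpha beta gamma (S k))).
  set (v := Cmod (term alpha beta gamma k)) in *.
  set (v' := Cmod (term alpha beta gamma (S k))) in *.
  set (x := INR k) in *.
  assert (Hpoly : (x * ((x + 1 / 2) * (x + g + e)) <= (x - 1 - e) * ((x + c) * (x + d)))%R).
  { assert (Hq : (0 <= tau / 4 * x² + B * x - F)%R).
    { assert (Hx : (Rabs B + Rabs F <= tau / 4 * x)%R).
      { apply Rmult_le_reg_r with (/ (tau / 4))%R; [apply Rinv_0_lt_compat; lra|].
        replace (tau / 4 * x * / (tau / 4))%R with x by (field; lra).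
        unfold Rdiv in H5 at 1. lra. }
      assert (Q1 := Rle_abs (- B)). assert (Q2 := Rle_abs F). rewrite Rabs_Ropp in Q1.
      assert (Q3 := Rabs_pos F). unfold Rsqr.
      assert (Q4 : ((Rabs B + Rabs F) * x <= tau / 4 * x * x)%R)
        by (apply Rmult_le_compat_r; lra).
      nra. }
    apply Rminus_le. apply Ropp_le_cancel. rewrite Ropp_0.
    replace (- (x * ((x + 1 / 2) * (x + g + e)) - (x - 1 - e) * ((x + c) * (x + d))))%R
      with ((c + d - g - 3 / 2 - 2 * e) * x² + B * x - F)%R
      by (unfold B, F, Rsqr; field).
    rewrite Hcd. unfold e at 1. replace (tau / 2 - 2 * (tau / 8))%R with (tau / 4)%R by field.
    exact Hq. }
  assert (Hxc : (0 < x + c)%R) by lra. assert (Hxd : (0 < x + d)%R) by lra.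
  assert (Hpos : (0 < (x + c) * (x + d))%R) by (apply Rmult_lt_0_compat; assumption).
  assert (S1 : ((x + c) * (x + d) * v' <= v * ((x + 1 / 2) * (x + g + e)))%R).
  { apply Rle_trans with (v' * Cmod (INC k + ((alpha + 1) / 2 + 1)) *
      Cmod (INC k + ((beta + 1) / 2 + 1)))%R.
    - rewrite (Rmult_comm _ v'), Rmult_assoc. apply Rmult_le_compat_l; [exact V'|].
      apply Rmult_le_compat; lra.
    - rewrite Heq, Rmult_assoc. apply Rmult_le_compat_l; [exact V|].
      apply Rmult_le_compat_l; lra. }
  apply Rmult_le_reg_l with ((x + c) * (x + d))%R; [exact Hpos|].
  apply Rle_trans with (v * (x * ((x + 1 / 2) * (x + g + e))))%R.
  - replace ((x + c) * (x + d) * (x * v'))%R with (x * ((x + c) * (x + d) * v'))%R by ring.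
    replace (v * (x * ((x + 1 / 2) * (x + g + e))))%R
      with (x * (v * ((x + 1 / 2) * (x + g + e))))%R by ring.
    apply Rmult_le_compat_l; [lra|exact S1].
  - replace ((x + c) * (x + d) * ((x - 1 - e) * v))%R
      with (v * ((x - 1 - e) * ((x + c) * (x + d))))%R by ring.
    apply Rmult_le_compat_l; [exact V|exact Hpoly].
Qed.
(** * Telescoping *)

(* [rho k n] is [2^n k! (2k-n)! / ((k-n)! (2k)!)], the ratio of the coefficients of [v^k]
   in [(1 - sqrt (1-v))^n / sqrt (1-v)] and in [1 / sqrt (1-v)]. For [k = n = 0] the
   recursive step is [0 / 0 = 0], as it should be. *)
Fixpoint rho (k n : nat) : R :=
  match n with
  | O => 1
  | S m => (rho k m * (2 * (INR k - INR m) / (2 * INR k - INR m)))%R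
  end.

Lemma rho_gt (k n : nat) : (k < n)%nat -> rho k n = 0%R.
Proof.
  intros H. induction n as [|n IH]; [lia|]. simpl.
  destruct (Nat.eq_dec k n) as [->|Hne].
  - unfold Rdiv. ring.
  - rewrite IH by lia. ring.
Qed.

(** For m < k a factor 2(k-m) / (2k-m) lies in [0,1]. This makes the remainder bound uniform in
    n. *)
Lemma rho_bounds (k n : nat) : (0 <= rho k n <= 1)%R.
Proof.
  induction n as [|n IH]; [simpl; lra|].
  destruct (Nat.le_gt_cases k n) as [H|H]; [rewrite rho_gt by lia; lra|].
  simpl. apply lt_INR in H. assert (Hn := pos_INR n).
  assert (H1 : (0 <= 2 * (INR k - INR n) / (2 * INR k - INR n) <= 1)%R).
  { split.
    - apply Rmult_le_pos; [lra|apply Rlt_le, Rinv_0_lt_compat; lra].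
    - apply Rmult_le_reg_r with (2 * INR k - INR n)%R; [lra|].
      unfold Rdiv. rewrite Rmult_assoc, Rinv_l by lra. lra. }
  nra.
Qed.

(** In the closed form of [rho] the factor (k-n)! is unchanged along the diagonal, so only a
    rational factor appears. The telescoping uses this to pass from K to K + 1. *)
Lemma rho_diag (k n : nat) :
  ((2 * INR k + 1) * rho (S k) (S n) = (2 * INR k + 1 - INR n) * rho k n)%R.
Proof.
  induction n as [|n IH].
  - cbn [rho]. rewrite S_INR. assert (H := pos_INR k). simpl INR. field. lra.
  - destruct (Nat.le_gt_cases k n) as [H|H]; [rewrite !rho_gt by lia; ring|].
    change (rho (S k) (S (S n))) with
      (rho (S k) (S n) * (2 * (INR (S k) - INR (S n)) / (2 * INR (S k) - INR (S n))))%R.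
    rewrite <- Rmult_assoc, IH. cbn [rho]. rewrite !S_INR.
    apply lt_INR in H. assert (Hn := pos_INR n). field. lra.
Qed.

Lemma INC_lt_neq (k n : nat) (z : R) :
  (INR n + z < 2 * INR k)%R ->
  2 * INC k - INC n - z <> 0.
Proof.
  intros H. unfold INC. rewrite <- RtoC_mult, <- !RtoC_minus.
  intros H0. apply RtoC_inj in H0. lra.
Qed.

Definition cf_a (alpha beta : C) : nat -> C :=
  fwd_diff (fun n : nat => INC n * (INC n + alpha) * (INC n + beta)).

Definition cf_b (alpha beta gamma : C) (n : nat) : C :=
  - 2 * INC n * (INC n + alpha) * (INC n + beta) * (INC n + gamma).

(** The bracket is the defect of the recurrence for M_n, between the indices m and m + 2, divided by
    (alpha+1)_{m+1} (beta+1)_{m+1}. The right side is a creative-telescoping certificate, checked by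
    induction on K. *)
Lemma rho_telescoping (alpha beta gamma : C) (m K : nat) :
  ~ nonpos_integer ((alpha + 1) / 2) -> ~ nonpos_integer ((beta + 1) / 2) ->
  sum_n (fun k =>
    ((INC (S (S m)) + alpha) * (INC (S (S m)) + beta) * rho k (S (S m))
     - cf_a alpha beta (S m) * rho k (S m)
     + 2 * INC (S m) * (INC (S m) + gamma) * rho k m) * term alpha beta gamma k) K =
  2 * INC (S m) * rho K m * term alpha beta gamma K * (INC K + (gamma + 1)).
Proof.
  intros Ha Hb. induction K as [|K IH].
  - rewrite sum_O. rewrite (rho_gt 0 (S m)), (rho_gt 0 (S (S m))) by lia.
    change (@eq _ ?x ?y) with (@eq C x y). destruct m as [|m].
    + rewrite !INC_S. unfold INC. simpl INR. ring.
    + rewrite (rho_gt 0 (S m)) by lia. ring.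
  - rewrite sum_Sn, IH. clear IH. change (plus ?x ?y) with (Cplus x y).
    change (@eq _ ?x ?y) with (@eq C x y).
    (* The rational identity needs nonzero denominators, guaranteed for m <= K. For m = K + 1 only
       the term with [rho (S K) m] survives, and beyond that every [rho] vanishes. *)
    destruct (Compare_dec.lt_eq_lt_dec m (S K)) as [[H|H]|H].
    + assert (Hu := term_S alpha beta gamma K Ha Hb).
      assert (Hd := f_equal RtoC (rho_diag K m)).
      rewrite !RtoC_mult, !RtoC_minus, !RtoC_plus, !RtoC_mult in Hd.
      change (RtoC (INR K)) with (INC K) in Hd. change (RtoC (INR m)) with (INC m) in Hd.
      assert (Hm := pos_INR m). assert (HK := pos_INR K).
      apply le_INR in H. rewrite !S_INR in H.
      assert (N1 : 2 * INC K + 1 - INC m <> 0).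
      { replace (2 * INC K + 1 - INC m) with (2 * INC (S K) - INC m - 1)
          by (rewrite INC_S; ring).
        apply INC_lt_neq. rewrite S_INR. lra. }
      assert (N2 : 2 * (INC K + 1) - INC m <> 0).
      { replace (2 * (INC K + 1) - INC m) with (2 * INC (S K) - INC m - 0)
          by (rewrite INC_S; ring).
        apply INC_lt_neq. rewrite S_INR. lra. }
      assert (N3 : 2 * INC K + 1 <> 0).
      { unfold INC. rewrite <- RtoC_mult, <- RtoC_plus. intros E. apply RtoC_inj in E. lra. }
      assert (R1 : RtoC (rho (S K) (S m)) =
        rho (S K) m * (2 * (INC (S K) - INC m) / (2 * INC (S K) - INC m))).
      { cbn [rho]. unfold INC. rewrite RtoC_mult, RtoC_div by (rewrite ?S_INR; lra).
        rewrite !RtoC_mult, !RtoC_minus, !RtoC_mult.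
        reflexivity. }
      assert (R2 : RtoC (rho (S K) (S (S m))) =
        rho (S K) (S m) * (2 * (INC (S K) - INC (S m)) / (2 * INC (S K) - INC (S m)))).
      { change (rho (S K) (S (S m))) with (rho (S K) (S m) *
          (2 * (INR (S K) - INR (S m)) / (2 * INR (S K) - INR (S m))))%R.
        unfold INC. rewrite RtoC_mult, RtoC_div by (rewrite ?S_INR; lra).
        rewrite !RtoC_mult, !RtoC_minus, !RtoC_mult.
        reflexivity. }
      (* The certificate at K is moved to K + 1 by [term_S] and [rho_diag]; their factors K + 1/2
         and 2K + 1 cancel up to the 2. Then all terms are rational multiples of [rho (S K) m * term
         alpha beta gamma (S K)]. *)
      assert (Hu' : rho K m * term alpha beta gamma K * (INC K + (gamma + 1)) =
        2 * rho (S K) (S m) / (2 * INC K + 1 - INC m) * (term alpha beta gamma (S K) *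
         (INC K + ((alpha + 1) / 2 + 1)) * (INC K + ((beta + 1) / 2 + 1)))).
      { rewrite Hu. rewrite !INC_S in *.
        replace (2 * rho (S K) (S m) / (2 * INC K + 1 - INC m)) with
          (2 * ((2 * INC K + 1) * rho (S K) (S m)) / ((2 * INC K + 1 - INC m) * (2 * INC K + 1))).
        - rewrite Hd. field. split; assumption.
        - field. split; assumption. }
      replace (2 * INC (S m) * rho K m * term alpha beta gamma K * (INC K + (gamma + 1)))
        with (2 * INC (S m) * (rho K m * term alpha beta gamma K * (INC K + (gamma + 1))))
        by ring.
      rewrite Hu', R2, R1.
      unfold cf_a, fwd_diff. rewrite !INC_S in *.
      set (t := term alpha beta gamma (S K)). set (r := RtoC (rho (S K) m)).
      field. repeat split; try assumption.
      intros E; apply N1; etransitivity; [|exact E]; ring.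
    + subst m. rewrite !(rho_gt (S K)), (rho_gt K) by lia.
      rewrite !INC_S. ring.
    + rewrite !(rho_gt (S K)), (rho_gt K) by lia. ring.
Qed.
(** * Perturbed second-order recurrences *)

(* In the coordinates [D n = y (n+1) - y n] and [E n = y (n+1) - 2 y n] the limit
   recurrence is diagonal with eigenvalues 2 and 1. The cone [|E| <= |D|] is
   invariant under a small perturbation, and outside it the growth is slow. *)
Lemma growth_dichotomy (p q y : nat -> C) (N : nat) :
  (forall n, (N <= n)%nat -> (Cmod (p n - 3) <= 1 / 100)%R) ->
  (forall n, (N <= n)%nat -> (Cmod (q n + 2) <= 1 / 100)%R) ->
  (forall n, (N <= n)%nat -> y (S (S n)) = p n * y (S n) + q n * y n) ->
  (exists (K : nat) (c : R), (0 < c)%R /\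
     forall n, (c * (19 / 10) ^ n <= Cmod (y (K + n)%nat))%R) \/
  (exists (K : nat) (c : R), (0 < c)%R /\
     forall n, (Cmod (y (K + n)%nat) <= c * (11 / 10) ^ n)%R).
Proof.
  intros Hp Hq Hy.
  set (D := fun n => y (S n) - y n). set (E := fun n => y (S n) - 2 * y n).
  assert (Hstep : forall n, (N <= n)%nat ->
    (Cmod (D (S n) - 2 * D n) <= (3 * Cmod (D n) + 2 * Cmod (E n)) / 100)%R /\
    (Cmod (E (S n) - E n) <= (3 * Cmod (D n) + 2 * Cmod (E n)) / 100)%R).
  { intros n Hn.
    (* Both D_{n+1} - 2 D_n and E_{n+1} - E_n equal (p_n - 3) y_{n+1} + (q_n + 2) y_n, with y_{n+1}
       = 2 D_n - E_n and y_n = D_n - E_n. *)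
    assert (He : (Cmod ((p n - 3) * (2 * D n - E n) + (q n + 2) * (D n - E n)) <=
      (3 * Cmod (D n) + 2 * Cmod (E n)) / 100)%R).
    { eapply Rle_trans; [apply Cmod_triangle|]. rewrite !Cmod_mult.
      assert (H1 := Cmod_triangle (2 * D n) (- E n)).
      assert (H2 := Cmod_triangle (D n) (- E n)).
      rewrite Cmod_opp in H1, H2. rewrite Cmod_mult, Cmod_R, Rabs_pos_eq in H1 by lra.
      change (2 * D n + - E n) with (2 * D n - E n) in H1.
      change (D n + - E n) with (D n - E n) in H2.
      specialize (Hp n Hn). specialize (Hq n Hn).
      assert (H3 := Cmod_ge_0 (2 * D n - E n)). assert (H4 := Cmod_ge_0 (D n - E n)).
      assert (H5 := Rmult_le_compat_r _ _ _ H3 Hp).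
      assert (H6 := Rmult_le_compat_r _ _ _ H4 Hq). lra. }
    split.
    - replace (D (S n) - 2 * D n)
        with ((p n - 3) * (2 * D n - E n) + (q n + 2) * (D n - E n)); [exact He|].
      unfold D, E. rewrite (Hy n Hn). ring.
    - replace (E (S n) - E n)
        with ((p n - 3) * (2 * D n - E n) + (q n + 2) * (D n - E n)); [exact He|].
      unfold D, E. rewrite (Hy n Hn). ring. }
  assert (HyDE : forall n, y n = D n - E n) by (intros n; unfold D, E; ring).
  assert (HE : forall n, (N <= n)%nat ->
    (Cmod (E (S n)) <= Cmod (E n) + (3 * Cmod (D n) + 2 * Cmod (E n)) / 100)%R).
  { intros n Hn. destruct (Hstep n Hn) as [_ H].
    assert (H1 := Cmod_triangle (E n) (E (S n) - E n)).
    replace (E n + (E (S n) - E n)) with (E (S n)) in H1 by ring. lra. }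
  assert (HD : forall n, (N <= n)%nat ->
    (2 * Cmod (D n) - (3 * Cmod (D n) + 2 * Cmod (E n)) / 100 <= Cmod (D (S n)))%R).
  { intros n Hn. destruct (Hstep n Hn) as [H _].
    assert (H1 := Cmod_triangle (D (S n)) (- (D (S n) - 2 * D n))).
    replace (D (S n) + - (D (S n) - 2 * D n)) with (2 * D n) in H1 by ring.
    rewrite Cmod_opp, Cmod_mult, Cmod_R, Rabs_pos_eq in H1 by lra. lra. }
  (* In the cone |D| grows by at least 1.95 and |E'| <= 1.05 |D|, so the orbit stays inside. If the
     cone with D nonzero is never entered, then |D| <= |E| throughout and |E| grows by at most
     1.05. *)
  destruct (Classical_Prop.classic (exists n, (N <= n)%nat /\ (0 < Cmod (D n))%R /\
    (Cmod (E n) <= Cmod (D n))%R)) as [[n0 [Hn0 [HD0 HE0]]]|Hno].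
  (* At [n0] itself D and E may cancel in y = D - E; one step later |y| >= (1.95 - 1.05) |D|, which
     covers the factor 1/2. *)
  - left. exists (S n0), (Cmod (D n0) / 2)%R. split; [lra|].
    assert (Hcone : forall n, (Cmod (D n0) * (19 / 10) ^ n <= Cmod (D (n0 + n)%nat))%R /\
      (Cmod (E (n0 + n)%nat) <= Cmod (D (n0 + n)%nat))%R).
    { induction n as [|n [IH1 IH2]].
      - replace (n0 + 0)%nat with n0 by lia. simpl. lra.
      - replace (n0 + S n)%nat with (S (n0 + n)) by lia.
        assert (H1 := HE (n0 + n)%nat ltac:(lia)). assert (H2 := HD (n0 + n)%nat ltac:(lia)).
        assert (H3 := Cmod_ge_0 (E (n0 + n)%nat)). assert (H4 := Cmod_ge_0 (D (n0 + n)%nat)).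
        simpl. lra. }
    intros n. destruct (Hcone n) as [H1 H2].
    replace (S n0 + n)%nat with (S (n0 + n)) by lia.
    assert (H3 := HE (n0 + n)%nat ltac:(lia)). assert (H4 := HD (n0 + n)%nat ltac:(lia)).
    assert (H5 := Cmod_triangle (y (S (n0 + n))) (E (S (n0 + n)))).
    rewrite HyDE in H5 at 1.
    replace (D (S (n0 + n)) - E (S (n0 + n)) + E (S (n0 + n))) with (D (S (n0 + n)))
      in H5 by ring.
    assert (H6 := Cmod_ge_0 (D (n0 + n)%nat)). lra.
  - right. exists N, (2 * Cmod (E N) + 1)%R. split; [assert (H := Cmod_ge_0 (E N)); lra|].
    assert (Hle : forall n, (N <= n)%nat -> (Cmod (D n) <= Cmod (E n))%R).
    { intros n Hn. apply Rnot_lt_le. intros Hlt. apply Hno. exists n.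
      assert (H := Cmod_ge_0 (E n)). repeat split; [exact Hn|lra|lra]. }
    assert (Hgr : forall n, (Cmod (E (N + n)%nat) <= Cmod (E N) * (11 / 10) ^ n)%R).
    { induction n as [|n IH].
      - replace (N + 0)%nat with N by lia. simpl. lra.
      - replace (N + S n)%nat with (S (N + n)) by lia.
        assert (H1 := HE (N + n)%nat ltac:(lia)). assert (H2 := Hle (N + n)%nat ltac:(lia)).
        assert (H3 := Cmod_ge_0 (E (N + n)%nat)). simpl. lra. }
    intros n. rewrite HyDE. eapply Rle_trans; [apply Cmod_triangle|]. rewrite Cmod_opp.
    specialize (Hgr n). specialize (Hle (N + n)%nat ltac:(lia)).
    assert (H := pow_le (11 / 10) n ltac:(lra)). lra.
Qed.

Lemma pow_dominates (c d r s : R) :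
  (0 < c)%R -> (0 < s < r)%R ->
  eventually (fun n => (d * s ^ n < c * r ^ n)%R).
Proof.
  intros Hc [Hs Hsr].
  destruct (Pow_x_infinity (r / s) ltac:(rewrite Rabs_pos_eq;
    [apply Rmult_lt_reg_r with s; [lra|]; field_simplify; lra
    | apply Rlt_le, Rdiv_lt_0_compat; lra]) (Rabs d / c + 1)%R) as [n Hn].
  exists n. intros k Hk. specialize (Hn k Hk). clear n Hk. rename k into n.
  assert (Hpos : (0 < s ^ n)%R) by (apply pow_lt; lra).
  rewrite Rabs_pos_eq in Hn
    by (apply pow_le, Rlt_le, Rdiv_lt_0_compat; lra).
  replace (r ^ n)%R with ((r / s) ^ n * s ^ n)%R
    by (rewrite <- Rpow_mult_distr; f_equal; field; lra).
  rewrite <- Rmult_assoc. apply Rmult_lt_compat_r; [exact Hpos|].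
  apply Rle_lt_trans with (Rabs d); [apply Rle_abs|].
  apply Rlt_le_trans with (c * (Rabs d / c + 1))%R.
  - field_simplify; lra.
  - apply Rmult_le_compat_l; lra.
Qed.

(* The Casoratian grows like [2^n], so two solutions cannot both be slow. *)
Lemma casoratian_growth (p q y z : nat -> C) (N : nat) :
  (forall n, (N <= n)%nat -> (Cmod (q n + 2) <= 1 / 100)%R) ->
  (forall n, (N <= n)%nat -> y (S (S n)) = p n * y (S n) + q n * y n) ->
  (forall n, (N <= n)%nat -> z (S (S n)) = p n * z (S n) + q n * z n) ->
  (exists (K : nat) (c : R), (0 < c)%R /\
     forall n, (Cmod (y (K + n)%nat) <= c * (11 / 10) ^ n)%R) ->
  (exists (K : nat) (c : R), (0 < c)%R /\
     forall n, (Cmod (z (K + n)%nat) <= c * (11 / 10) ^ n)%R) ->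
  forall n, (N <= n)%nat -> y n * z (S n) - y (S n) * z n = 0.
Proof.
  intros Hq Hy Hz [K1 [c1 [Hc1 H1]]] [K2 [c2 [Hc2 H2]]].
  set (w := fun n => y n * z (S n) - y (S n) * z n).
  assert (Hw : forall n, (N <= n)%nat -> w (S n) = - q n * w n).
  { intros n Hn. unfold w. rewrite Hy, Hz by exact Hn. ring. }
  (* Each step multiplies the Casoratian by -q, and |q| >= 2 - 1/100. *)
  assert (Hwg : forall n m, (N <= n)%nat ->
    (Cmod (w n) * (19 / 10) ^ m <= Cmod (w (n + m)%nat))%R).
  { intros n m Hn. induction m as [|m IH].
    - replace (n + 0)%nat with n by lia. simpl. lra.
    - replace (n + S m)%nat with (S (n + m)) by lia.
      rewrite Hw by lia. rewrite Cmod_mult, Cmod_opp.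
      specialize (Hq (n + m)%nat ltac:(lia)).
      assert (Ht := Cmod_triangle (q (n + m)%nat + 2) (- q (n + m)%nat)).
      replace (q (n + m)%nat + 2 + - q (n + m)%nat) with (RtoC 2) in Ht by ring.
      rewrite Cmod_opp, Cmod_R, Rabs_pos_eq in Ht by lra.
      assert (H := Cmod_ge_0 (w (n + m)%nat)). simpl. nra. }
  intros n Hn. change (w n = 0).
  destruct (Ceq_dec (w n) 0) as [H0|H0]; [exact H0|exfalso].
  set (L := (n + (K1 + K2))%nat).
  assert (HL : (0 < Cmod (w L))%R).
  { apply Rlt_le_trans with (Cmod (w n) * (19 / 10) ^ (K1 + K2))%R; [|apply Hwg, Hn].
    apply Rmult_lt_0_compat; [apply Cmod_gt_0, H0|apply pow_lt; lra]. }
  assert (Hb1 : forall m, (Cmod (y (L + m)%nat) <=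
      c1 * (11 / 10) ^ (L - K1) * (11 / 10) ^ m)%R).
  { intros m. rewrite Rmult_assoc, <- pow_add.
    replace (L + m)%nat with (K1 + (L - K1 + m))%nat by (unfold L; lia). apply H1. }
  assert (Hb2 : forall m, (Cmod (z (L + m)%nat) <=
      c2 * (11 / 10) ^ (L - K2) * (11 / 10) ^ m)%R).
  { intros m. rewrite Rmult_assoc, <- pow_add.
    replace (L + m)%nat with (K2 + (L - K2 + m))%nat by (unfold L; lia). apply H2. }
  set (d1 := (c1 * (11 / 10) ^ (L - K1))%R) in *.
  set (d2 := (c2 * (11 / 10) ^ (L - K2))%R) in *.
  (* Two slow solutions bound the Casoratian by 2 (11/10) d1 d2 (121/100)^m, and 121/100 < 19/10. *)
  destruct (pow_dominates (Cmod (w L)) (d1 * d2 * 3) (19 / 10) (121 / 100)) as [m Hm];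
    [exact HL|lra|].
  specialize (Hm m (Nat.le_refl m)).
  specialize (Hwg L m ltac:(unfold L; lia)).
  assert (Hup : (Cmod (w (L + m)%nat) <= d1 * d2 * 3 * (121 / 100) ^ m)%R).
  { unfold w. eapply Rle_trans; [apply Cmod_triangle|]. rewrite Cmod_opp, !Cmod_mult.
    assert (Ha := Hb1 m). assert (Hb := Hb1 (S m)).
    assert (Hc := Hb2 m). assert (Hd := Hb2 (S m)).
    rewrite <- !plus_n_Sm in *. simpl in Hb, Hd.
    replace (121 / 100)%R with (11 / 10 * (11 / 10))%R by lra. rewrite Rpow_mult_distr.
    set (r := ((11 / 10) ^ m)%R) in *.
    assert (Hr : (0 < r)%R) by (apply pow_lt; lra).
    assert (G1 := Rmult_le_compat _ _ _ _ (Cmod_ge_0 _) (Cmod_ge_0 _) Ha Hd).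
    assert (G2 := Rmult_le_compat _ _ _ _ (Cmod_ge_0 _) (Cmod_ge_0 _) Hb Hc).
    assert (0 <= d1 * d2 * (r * r))%R.
    { apply Rmult_le_pos; [|nra].
      apply Rmult_le_pos; apply Rmult_le_pos; try lra; apply pow_le; lra. }
    nra. }
  lra.
Qed.
(** * The remainder as a series *)

Lemma INR_plus_mult_lim_0 (v : nat -> R) (c : R) :
  ex_series v -> is_lim_seq (fun k => (INR k * v (S k))%R) 0%R ->
  is_lim_seq (fun k => ((INR k + c) * v k)%R) 0%R.
Proof.
  intros Hv Hk. apply is_lim_seq_incr_1.
  apply is_lim_seq_ext with (fun k => (INR k * v (S k) + (1 + c) * v (S k))%R).
  { intros k. rewrite S_INR. ring. }
  replace (Finite 0) with (Finite (0 + (1 + c) * 0)) by (f_equal; ring).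
  apply is_lim_seq_plus'; [exact Hk|].
  apply (is_lim_seq_scal_l (fun k => v (S k)) (1 + c) 0).
  apply -> is_lim_seq_incr_1. apply ex_series_lim_0, Hv.
Qed.

(** The certificate tends to 0 as K grows, because [rho] is bounded and K u_K tends to 0 by the
    second half of [term_raabe]. *)
Lemma rho_telescoping_series (alpha beta gamma : C) (m : nat) :
  (Re (2 * gamma - alpha - beta) < 1)%R ->
  ~ nonpos_integer ((alpha + 1) / 2) -> ~ nonpos_integer ((beta + 1) / 2) ->
  is_series (fun k =>
    ((INC (S (S m)) + alpha) * (INC (S (S m)) + beta) * rho k (S (S m))
     - cf_a alpha beta (S m) * rho k (S m)
     + 2 * INC (S m) * (INC (S m) + gamma) * rho k m) * term alpha beta gamma k) (RtoC 0).
Proof.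
  intros Hre Ha Hb. apply Cis_series_Cmod. intros eps Heps.
  destruct (term_raabe alpha beta gamma Hre Ha Hb) as [Hex Hlim].
  assert (H := INR_plus_mult_lim_0 _ (Cmod (gamma + 1)) Hex Hlim).
  apply is_lim_seq_spec in H.
  assert (Hn : (0 < 2 * INR (S m))%R) by (assert (H' := lt_0_INR (S m) ltac:(lia)); lra).
  generalize (H (mkposreal (eps / (2 * INR (S m))) (Rdiv_lt_0_compat _ _ Heps Hn))).
  apply filter_imp. intros k Hk. simpl pos in Hk. rewrite Rminus_0_r in Hk.
  rewrite rho_telescoping by assumption.
  assert (Hm0 : forall z : C, z - 0 = z) by (intros z; ring). rewrite Hm0.
  rewrite !Cmod_mult. unfold INC at 1. rewrite !Cmod_R.
  rewrite (Rabs_pos_eq 2), (Rabs_pos_eq (INR (S m))), (Rabs_pos_eq (rho k m))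
    by first [apply pos_INR | apply rho_bounds | lra].
  assert (Hr := rho_bounds k m).
  assert (Ht := Cmod_ge_0 (term alpha beta gamma k)).
  assert (Hg : (Cmod (INC k + (gamma + 1)) <= INR k + Cmod (gamma + 1))%R).
  { eapply Rle_trans; [apply Cmod_triangle|]. unfold INC at 1.
    rewrite Cmod_R, Rabs_pos_eq by apply pos_INR. lra. }
  assert (Hg0 := Cmod_ge_0 (INC k + (gamma + 1))).
  apply Rle_lt_trans with
    (2 * INR (S m) * ((INR k + Cmod (gamma + 1)) * Cmod (term alpha beta gamma k)))%R.
  - replace (2 * INR (S m) * rho k m * Cmod (term alpha beta gamma k) *
      Cmod (INC k + (gamma + 1)))%R
      with (2 * INR (S m) * (rho k m * (Cmod (INC k + (gamma + 1)) *
        Cmod (term alpha beta gamma k))))%R by ring.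
    apply Rmult_le_compat_l; [lra|].
    assert (P1 := Rmult_le_compat_r _ _ _ Ht Hg).
    assert (P0 := Rmult_le_pos _ _ Hg0 Ht). nra.
  - apply Rle_lt_trans with
      (2 * INR (S m) * Rabs ((INR k + Cmod (gamma + 1)) * Cmod (term alpha beta gamma k)))%R.
    + apply Rmult_le_compat_l; [lra|]. apply Rle_abs.
    + apply Rlt_le_trans with (2 * INR (S m) * (eps / (2 * INR (S m))))%R.
      * apply Rmult_lt_compat_l; assumption.
      * right. field. lra.
Qed.

Definition num (alpha beta gamma : C) (n : nat) : C :=
  CF_num (cf_a alpha beta) (cf_b alpha beta gamma) n.

Definition den (alpha beta gamma : C) (n : nat) : C :=
  CF_den (cf_a alpha beta) (cf_b alpha beta gamma) n.

Definition weight (alpha beta : C) (n : nat) : C :=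
  pochhammer (alpha + 1) n * pochhammer (beta + 1) n.

Lemma num_SS (alpha beta gamma : C) (n : nat) :
  num alpha beta gamma (S (S n)) =
  cf_a alpha beta (S n) * num alpha beta gamma (S n) +
  cf_b alpha beta gamma (S n) * num alpha beta gamma n.
Proof. reflexivity. Qed.

Lemma den_SS (alpha beta gamma : C) (n : nat) :
  den alpha beta gamma (S (S n)) =
  cf_a alpha beta (S n) * den alpha beta gamma (S n) +
  cf_b alpha beta gamma (S n) * den alpha beta gamma n.
Proof. reflexivity. Qed.

Lemma Cis_series_lin (c d : C) (a b : nat -> C) (x y : C) :
  is_series a x -> is_series b y ->
  is_series (fun k => c * a k + d * b k) (c * x + d * y).
Proof.
  intros Ha Hb.
  exact (is_series_plus _ _ _ _ (is_series_scal c _ _ Ha) (is_series_scal d _ _ Hb)).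
Qed.

Lemma nonpos_integer_half_neq_0 (x : C) : ~ nonpos_integer ((x + 1) / 2) -> x + 1 <> 0.
Proof.
  intros Hx H. apply Hx. exists O. rewrite H. change (INC 0) with (RtoC 0). field.
Qed.

(** Both sides satisfy the recurrence of the continued fraction, the series by
    [rho_telescoping_series]; so it suffices to compare them at n = 0 and n = 1, and the induction
    carries two consecutive indices. *)
Lemma remainder_series (alpha beta gamma s : C) (n : nat) :
  (Re (2 * gamma - alpha - beta) < 1)%R ->
  ~ nonpos_integer ((alpha + 1) / 2) -> ~ nonpos_integer ((beta + 1) / 2) ->
  is_series (term alpha beta gamma) s ->
  is_series (fun k => weight alpha beta n * (rho k n * term alpha beta gamma k))
    (s * num alpha beta gamma n - 4 * den alpha beta gamma n).
Proof.
  intros Hre Ha Hb Hs.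
  enough (H : is_series (fun k => weight alpha beta n * (rho k n * term alpha beta gamma k))
    (s * num alpha beta gamma n - 4 * den alpha beta gamma n) /\
    is_series (fun k => weight alpha beta (S n) * (rho k (S n) * term alpha beta gamma k))
    (s * num alpha beta gamma (S n) - 4 * den alpha beta gamma (S n))) by apply H.
  induction n as [|n [IH1 IH2]]; split.
  - replace (s * num alpha beta gamma 0 - 4 * den alpha beta gamma 0) with s
      by (unfold num, den; simpl; ring).
    eapply is_series_ext; [|exact Hs]. intros k. unfold weight. simpl.
    change (@eq _ ?x ?y) with (@eq C x y). ring.
  - apply Cis_series_Cmod. intros eps Heps.
    assert (HN1 := nonpos_integer_half_neq_0 alpha Ha).
    assert (HN2 := nonpos_integer_half_neq_0 beta Hb).
    assert (Hw : weight alpha beta 1 = (1 + alpha) * (1 + beta))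
      by (unfold weight; cbn [pochhammer]; change (INC 0) with (RtoC 0); ring).
    assert (Hw0 : (0 < Cmod (weight alpha beta 1))%R).
    { apply Cmod_gt_0. rewrite Hw. apply Cmult_neq_0; rewrite Cplus_comm; assumption. }
    (* The 4 of the theorem: u_0 has the denominator (alpha+1)(beta+1)/4. *)
    assert (Ht0 : weight alpha beta 1 * term alpha beta gamma 0 = 4).
    { rewrite Hw. unfold term. cbn [pochhammer Nat.add].
      change (INC 0) with (RtoC 0). field.
      repeat split; try assumption; rewrite Cplus_comm; assumption. }
    assert (Hn1 : num alpha beta gamma 1 = weight alpha beta 1).
    { rewrite Hw. unfold num. cbn [CF_num]. unfold cf_a, fwd_diff.
      rewrite INC_S. change (INC 0) with (RtoC 0). ring. }
    (* [rho k 1] is 0 for k = 0 and 1 otherwise, so passing to n = 1 just drops u_0. *)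
    assert (Hsum : forall K, sum_n (fun k => weight alpha beta 1 *
      (rho k 1 * term alpha beta gamma k)) K =
      weight alpha beta 1 * sum_n (term alpha beta gamma) K - 4).
    { induction K as [|K IH].
      - rewrite !sum_O. rewrite rho_gt by lia. rewrite Ht0.
        change (@eq _ ?x ?y) with (@eq C x y). ring.
      - rewrite !sum_Sn, IH. change (plus ?x ?y) with (Cplus x y).
        change (@eq _ ?x ?y) with (@eq C x y).
        replace (rho (S K) 1) with 1%R; [ring|].
        cbn [rho]. rewrite S_INR. change (INR 0) with 0%R.
        assert (H := pos_INR K). field. lra. }
    generalize (proj1 (Cis_series_Cmod _ _) Hs _ (Rdiv_lt_0_compat _ _ Heps Hw0)).
    apply filter_imp. intros K HK. rewrite Hsum, Hn1. unfold den. simpl CF_den.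
    replace (weight alpha beta 1 * sum_n (term alpha beta gamma) K - 4 -
      (s * weight alpha beta 1 - 4 * 1)) with
      (weight alpha beta 1 * (sum_n (term alpha beta gamma) K - s)) by ring.
    rewrite Cmod_mult.
    apply Rlt_le_trans with
      (Cmod (weight alpha beta 1) * (eps / Cmod (weight alpha beta 1)))%R.
    + apply Rmult_lt_compat_l; assumption.
    + right. field. lra.
  - exact IH2.
  - assert (HT := rho_telescoping_series alpha beta gamma n Hre Ha Hb).
    assert (H := Cis_series_lin 1 (weight alpha beta (S n)) _ _ _ _
      (Cis_series_lin (cf_a alpha beta (S n)) (cf_b alpha beta gamma (S n)) _ _ _ _ IH2 IH1)
      HT).
    replace (s * num alpha beta gamma (S (S n)) - 4 * den alpha beta gamma (S (S n))) with
     (1 * (cf_a alpha beta (S n) * (s * num alpha beta gamma (S n) -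
        4 * den alpha beta gamma (S n)) + cf_b alpha beta gamma (S n) *
        (s * num alpha beta gamma n - 4 * den alpha beta gamma n)) +
        weight alpha beta (S n) * 0)
     by (rewrite num_SS, den_SS; ring).
    eapply is_series_ext; [|exact H]. intros k. cbv beta.
    change (@eq _ ?x ?y) with (@eq C x y).
    unfold weight, cf_b. cbn [pochhammer]. rewrite !INC_S. ring.
Qed.

(** Since 0 <= [rho] <= 1, the sum of the |u_k| serves as [T] for all n at once. *)
Lemma remainder_bound (alpha beta gamma s : C) :
  (Re (2 * gamma - alpha - beta) < 1)%R ->
  ~ nonpos_integer ((alpha + 1) / 2) -> ~ nonpos_integer ((beta + 1) / 2) ->
  is_series (term alpha beta gamma) s ->
  exists T : R, forall n,
    (Cmod (s * num alpha beta gamma n - 4 * den alpha beta gamma n)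
     <= T * Cmod (weight alpha beta n))%R.
Proof.
  intros Hre Ha Hb Hs.
  destruct (term_raabe alpha beta gamma Hre Ha Hb) as [Hex _].
  exists (Series (fun k => Cmod (term alpha beta gamma k))). intros n.
  apply (Cmod_is_series_le _ _ _ (remainder_series alpha beta gamma s n Hre Ha Hb Hs)).
  intros K.
  apply Rle_trans with (Cmod (weight alpha beta n) *
    sum_n (fun k => Cmod (term alpha beta gamma k)) K)%R.
  - rewrite <- (sum_n_mult_l (K := R_Ring)).
    apply sum_n_m_le. intros k. change (mult ?x ?y) with (x * y)%R.
    rewrite !Cmod_mult, Cmod_R, Rabs_pos_eq by apply rho_bounds.
    apply Rmult_le_compat_l; [apply Cmod_ge_0|].
    assert (H := rho_bounds k n). assert (H' := Cmod_ge_0 (term alpha beta gamma k)). nra.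
  - rewrite Rmult_comm. apply Rmult_le_compat_r; [apply Cmod_ge_0|].
    apply Series_correct in Hex.
    apply (is_lim_seq_incr_compare _ _ Hex). intros j. rewrite sum_Sn.
    change (plus ?x ?y) with (x + y)%R.
    assert (H := Cmod_ge_0 (term alpha beta gamma (S j))). lra.
Qed.
(** * Growth of the numerators *)

Lemma INC_S_neq_0 (n : nat) : INC (S n) <> 0.
Proof. intros H. apply RtoC_inj in H. now apply (not_0_INR (S n)). Qed.

(** Degree 2 over degree 3. The denominator (n+1)(n+2)^2 is common to [coef_p - 3] and
    [coef_q + 2]. *)
Lemma quad_ratio_small (c2 c1 c0 : C) :
  eventually (fun n => (Cmod ((c2 * (INC (S n) * INC (S n)) + c1 * INC (S n) + c0) /
    (INC (S n) * (INC (S (S n)) * INC (S (S n))))) <= 1 / 100)%R).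
Proof.
  set (c := (Cmod c2 + Cmod c1 + Cmod c0)%R).
  generalize (eventually_INR_ge (100 * c)). apply filter_imp. intros n Hn.
  rewrite Cmod_div by
    (repeat apply Cmult_neq_0; apply INC_S_neq_0).
  rewrite !Cmod_mult. unfold INC at 4 5 6. rewrite !Cmod_R, !Rabs_pos_eq by apply pos_INR.
  assert (Hx : (INR (S n) = INR n + 1)%R) by apply S_INR.
  assert (Hy : (INR (S (S n)) = INR n + 2)%R) by (rewrite !S_INR; ring).
  assert (H0 := pos_INR n).
  assert (Hc : (Cmod (c2 * (INC (S n) * INC (S n)) + c1 * INC (S n) + c0) <=
    c * ((INR n + 1) * (INR n + 1)))%R).
  { eapply Rle_trans; [apply Cmod_triangle|].
    assert (H := Cmod_triangle (c2 * (INC (S n) * INC (S n))) (c1 * INC (S n))).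
    rewrite !Cmod_mult in H. unfold INC in H at 4 5 6.
    rewrite !Cmod_R, !Rabs_pos_eq, !Hx in H by apply pos_INR.
    assert (H1 := Cmod_ge_0 c1). assert (H2 := Cmod_ge_0 c0). unfold c. nra. }
  rewrite Hx, Hy.
  assert (Hd : (0 < (INR n + 1) * ((INR n + 2) * (INR n + 2)))%R)
    by (repeat apply Rmult_lt_0_compat; lra).
  apply Rmult_le_reg_r with ((INR n + 1) * ((INR n + 2) * (INR n + 2)))%R; [exact Hd|].
  unfold Rdiv at 1. rewrite Rmult_assoc, Rinv_l, Rmult_1_r by lra.
  eapply Rle_trans; [exact Hc|].
  apply Rle_trans with ((INR n / 100) * ((INR n + 1) * (INR n + 1)))%R.
  - apply Rmult_le_compat_r; nra.
  - nra.
Qed.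

(** * Normalization of the recurrence by n!^2 *)

Definition fact_sq (n : nat) : C := RtoC (INR (fact n) * INR (fact n)).

Lemma fact_sq_pos (n : nat) : (0 < INR (fact n) * INR (fact n))%R.
Proof. assert (H := INR_fact_lt_0 n). nra. Qed.

Lemma fact_sq_neq_0 (n : nat) : fact_sq n <> 0.
Proof. intros H. apply RtoC_inj in H. assert (H' := fact_sq_pos n). lra. Qed.

Lemma fact_sq_S (n : nat) : fact_sq (S n) = INC (S n) * INC (S n) * fact_sq n.
Proof.
  unfold fact_sq, INC. rewrite fact_simpl, mult_INR, !RtoC_mult. ring.
Qed.

Lemma Cmod_fact_sq (n : nat) : Cmod (fact_sq n) = (INR (fact n) * INR (fact n))%R.
Proof.
  unfold fact_sq. rewrite Cmod_R, Rabs_pos_eq; [reflexivity|].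
  apply Rlt_le, fact_sq_pos.
Qed.

(** Coefficients of the recurrence for x_n / n!^2. The limits are 3 for [coef_p] and -2 for
    [coef_q], and t^2 - 3t + 2 has the roots 1 and 2. *)
Definition coef_p (alpha beta : C) (n : nat) : C :=
  cf_a alpha beta (S n) / (INC (S (S n)) * INC (S (S n))).

Definition coef_q (alpha beta gamma : C) (n : nat) : C :=
  cf_b alpha beta gamma (S n) /
  (INC (S (S n)) * INC (S (S n)) * (INC (S n) * INC (S n))).

Lemma coef_p_lim (alpha beta : C) :
  eventually (fun n => (Cmod (coef_p alpha beta n - 3) <= 1 / 100)%R).
Proof.
  generalize (quad_ratio_small (2 * (alpha + beta) - 3) (alpha + beta + alpha * beta - 2) 0).
  apply filter_imp. intros n Hn. eapply Rle_trans; [|exact Hn]. right. f_equal.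
  assert (H1 := INC_S_neq_0 n). assert (H2 := INC_S_neq_0 (S n)).
  unfold coef_p, cf_a, fwd_diff. rewrite !INC_S in *. field. split; assumption.
Qed.

Lemma coef_q_lim (alpha beta gamma : C) :
  eventually (fun n => (Cmod (coef_q alpha beta gamma n + 2) <= 1 / 100)%R).
Proof.
  generalize (quad_ratio_small (2 * (2 - (alpha + beta + gamma)))
    (2 * (1 - (alpha * beta + alpha * gamma + beta * gamma)))
    (- 2 * (alpha * beta * gamma))).
  apply filter_imp. intros n Hn. eapply Rle_trans; [|exact Hn]. right. f_equal.
  assert (H1 := INC_S_neq_0 n). assert (H2 := INC_S_neq_0 (S n)).
  unfold coef_q, cf_b. rewrite !INC_S in *. field. split; assumption.
Qed.

Lemma normalized_rec (alpha beta gamma : C) (x : nat -> C) (n : nat) :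
  x (S (S n)) = cf_a alpha beta (S n) * x (S n) + cf_b alpha beta gamma (S n) * x n ->
  x (S (S n)) / fact_sq (S (S n)) =
  coef_p alpha beta n * (x (S n) / fact_sq (S n)) +
  coef_q alpha beta gamma n * (x n / fact_sq n).
Proof.
  intros Hx. rewrite Hx, !fact_sq_S. unfold coef_p, coef_q.
  assert (H1 := INC_S_neq_0 n). assert (H2 := INC_S_neq_0 (S n)).
  assert (H3 := fact_sq_neq_0 n). field. repeat split; assumption.
Qed.

(** The constant is chosen so that (26/25)^2 < 11/10, as [weight_growth] multiplies two such
    bounds. *)
Lemma Cmod_INC_plus_le_mult (z : C) :
  eventually (fun k => (Cmod (z + 1 + INC k) <= 26 / 25 * INR (S k))%R).
Proof.
  generalize (eventually_INR_ge (25 * Cmod (z + 1))). apply filter_imp. intros k Hk.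
  eapply Rle_trans; [apply Cmod_triangle|]. unfold INC.
  rewrite (Cmod_R (INR k)), Rabs_pos_eq, S_INR by apply pos_INR. lra.
Qed.

Lemma weight_growth (alpha beta : C) :
  exists (K : nat) (c : R), (0 < c)%R /\
  forall n, (Cmod (weight alpha beta (K + n)) <=
    c * (11 / 10) ^ n * Cmod (fact_sq (K + n)))%R.
Proof.
  destruct (filter_and _ _ (Cmod_INC_plus_le_mult alpha) (Cmod_INC_plus_le_mult beta))
    as [K HK].
  exists K, (Cmod (weight alpha beta K) + 1)%R.
  assert (H0 := Cmod_ge_0 (weight alpha beta K)). split; [lra|].
  induction n as [|n IH].
  - replace (K + 0)%nat with K by lia. simpl.
    assert (H1 : (1 <= Cmod (fact_sq K))%R).
    { rewrite Cmod_fact_sq. assert (H := lt_O_fact K). apply le_INR in H.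
      simpl (INR 1) in H. nra. }
    nra.
  - replace (K + S n)%nat with (S (K + n)) by lia.
    destruct (HK (K + n)%nat ltac:(lia)) as [Ha Hb].
    replace (weight alpha beta (S (K + n))) with (weight alpha beta (K + n) *
      ((alpha + 1 + INC (K + n)) * (beta + 1 + INC (K + n))))
      by (unfold weight; cbn [pochhammer]; ring).
    rewrite fact_sq_S, !Cmod_mult. unfold INC at 3 4.
    rewrite Cmod_R, Rabs_pos_eq by apply pos_INR.
    assert (P := Rmult_le_compat _ _ _ _ (Cmod_ge_0 _) (Cmod_ge_0 _) Ha Hb).
    set (N := INR (S (K + n))) in *.
    assert (P2 : (Cmod (alpha + 1 + INC (K + n)) * Cmod (beta + 1 + INC (K + n)) <=
      11 / 10 * (N * N))%R) by nra.
    assert (Q := Rmult_le_compat _ _ _ _ (Cmod_ge_0 _)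
      (Rmult_le_pos _ _ (Cmod_ge_0 _) (Cmod_ge_0 _)) IH P2).
    eapply Rle_trans; [exact Q|]. right. simpl. ring.
Qed.

(** * Casoratians and the case of nonvanishing partial numerators *)

Lemma casoratian_S (a b : nat -> C) (n : nat) :
  CF_num a b (S n) * CF_den a b (S (S n)) - CF_num a b (S (S n)) * CF_den a b (S n) =
  - b (S n) * (CF_num a b n * CF_den a b (S n) - CF_num a b (S n) * CF_den a b n).
Proof.
  change (CF_num a b (S (S n))) with (a (S n) * CF_num a b (S n) + b (S n) * CF_num a b n).
  change (CF_den a b (S (S n))) with (a (S n) * CF_den a b (S n) + b (S n) * CF_den a b n).
  ring.
Qed.

(** The Casoratian starts at 1 and picks up a factor -b_j at each step. Only b_1, ..., b_n enter, so
    the lemma still applies just before the first vanishing b_j. *)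
Lemma casoratian_neq_0 (a b : nat -> C) (n : nat) :
  (forall j, (j < n)%nat -> b (S j) <> 0) ->
  CF_num a b n * CF_den a b (S n) - CF_num a b (S n) * CF_den a b n <> 0.
Proof.
  induction n as [|n IH]; intros Hb.
  - simpl. replace (1 * 1 - a O * 0) with (RtoC 1) by ring. apply C1_nz.
  - rewrite casoratian_S. apply Cmult_neq_0; [|apply IH; intros j Hj; apply Hb; lia].
    intros H. apply (Hb n); [lia|]. replace (b (S n)) with (- - b (S n)) by ring.
    rewrite H. ring.
Qed.

Definition admissible (alpha beta gamma : C) : Prop :=
  (Re (2 * gamma - alpha - beta) < 1)%R /\
  ~ nonpos_integer ((alpha + 1) / 2) /\ ~ nonpos_integer ((beta + 1) / 2) /\
  ~ nonpos_integer (gamma + 1).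

(** After division by n!^2 the remainder is slow, so it is enough that the numerators are fast: then
    the quotient decays like (11/19)^n up to a constant. *)
Lemma num_dominates (alpha beta gamma s : C) :
  admissible alpha beta gamma -> is_series (term alpha beta gamma) s ->
  (forall n, cf_b alpha beta gamma (S n) <> 0) ->
  forall eps : R, (0 < eps)%R -> eventually (fun n =>
    (Cmod (s * num alpha beta gamma n - 4 * den alpha beta gamma n) <
      eps * Cmod (num alpha beta gamma n))%R).
Proof.
  intros [Hre [Ha [Hb Hg]]] Hs Hnz.
  set (M := fun n => s * num alpha beta gamma n - 4 * den alpha beta gamma n).
  destruct (remainder_bound alpha beta gamma s Hre Ha Hb Hs) as [T HT].
  assert (HMslow : exists (K : nat) (c : R), (0 < c)%R /\
     forall n, (Cmod (M (K + n)%nat / fact_sq (K + n)) <= c * (11 / 10) ^ n)%R).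
  { destruct (weight_growth alpha beta) as [K [c [Hc HK]]].
    assert (HT0 := Rle_abs T). assert (HT1 := Rabs_pos T).
    exists K, ((Rabs T + 1) * c)%R. split; [nra|]. intros n.
    rewrite Cmod_div by apply fact_sq_neq_0.
    assert (Hf : (0 < Cmod (fact_sq (K + n)))%R) by apply Cmod_gt_0, fact_sq_neq_0.
    apply Rmult_le_reg_r with (Cmod (fact_sq (K + n))); [exact Hf|].
    unfold Rdiv. rewrite Rmult_assoc, Rinv_l, Rmult_1_r by lra.
    eapply Rle_trans; [apply HT|].
    assert (Hw := Cmod_ge_0 (weight alpha beta (K + n))). specialize (HK n).
    apply Rle_trans with ((Rabs T + 1) * Cmod (weight alpha beta (K + n)))%R; [nra|].
    rewrite !Rmult_assoc. rewrite !Rmult_assoc in HK.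
    apply Rmult_le_compat_l; [lra|exact HK]. }
  destruct (filter_and _ _ (coef_p_lim alpha beta) (coef_q_lim alpha beta gamma))
    as [N HN].
  assert (HA : forall n, num alpha beta gamma (S (S n)) / fact_sq (S (S n)) =
    coef_p alpha beta n * (num alpha beta gamma (S n) / fact_sq (S n)) +
    coef_q alpha beta gamma n * (num alpha beta gamma n / fact_sq n)).
  { intros n. apply (normalized_rec alpha beta gamma (num alpha beta gamma)). apply num_SS. }
  assert (HM : forall n, M (S (S n)) / fact_sq (S (S n)) =
    coef_p alpha beta n * (M (S n) / fact_sq (S n)) +
    coef_q alpha beta gamma n * (M n / fact_sq n)).
  { intros n. apply (normalized_rec alpha beta gamma M). unfold M.
    rewrite num_SS, den_SS. ring. }
  destruct (growth_dichotomy _ _ (fun n => num alpha beta gamma n / fact_sq n) N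
    (fun n Hn => proj1 (HN n Hn)) (fun n Hn => proj2 (HN n Hn)) (fun n _ => HA n))
    as [Hfast|Hslow].
  - destruct Hfast as [K1 [c1 [Hc1 H1]]]. destruct HMslow as [K2 [c2 [Hc2 H2]]].
    intros eps Heps.
    (* The two bounds start at [K1] and [K2]; both are compared at the exponent n - K1 - K2, and the
       surplus (19/10)^K2 >= 1 is dropped. *)
    destruct (pow_dominates (eps * c1) (c2 * (11 / 10) ^ K1) (19 / 10) (11 / 10)
      ltac:(nra) ltac:(lra)) as [L HL].
    exists (K1 + K2 + L)%nat. intros n Hn. fold (M n).
    assert (G1 := H1 (n - K1)%nat). replace (K1 + (n - K1))%nat with n in G1 by lia.
    assert (G2 := H2 (n - K2)%nat). replace (K2 + (n - K2))%nat with n in G2 by lia.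
    replace (n - K1)%nat with ((n - K1 - K2) + K2)%nat in G1 by lia.
    replace (n - K2)%nat with (K1 + (n - K1 - K2))%nat in G2 by lia.
    specialize (HL (n - K1 - K2)%nat ltac:(lia)).
    rewrite pow_add in G1, G2.
    assert (Hf : (0 < Cmod (fact_sq n))%R) by apply Cmod_gt_0, fact_sq_neq_0.
    rewrite Cmod_div in G1, G2 by apply fact_sq_neq_0.
    set (x := ((19 / 10) ^ (n - K1 - K2))%R) in *.
    assert (Hx : (0 < x)%R) by (apply pow_lt; lra).
    assert (Hp : (1 <= (19 / 10) ^ K2)%R) by (apply pow_R1_Rle; lra).
    assert (G3 : (Cmod (M n) / Cmod (fact_sq n) <
      eps * (Cmod (num alpha beta gamma n) / Cmod (fact_sq n)))%R).
    { apply Rle_lt_trans with (1 := G2). rewrite <- Rmult_assoc.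
      apply Rlt_le_trans with (1 := HL). rewrite Rmult_assoc.
      apply Rmult_le_compat_l; [lra|]. eapply Rle_trans; [|exact G1].
      apply Rmult_le_compat_l; [lra|]. nra. }
    apply Rmult_lt_reg_r with (/ Cmod (fact_sq n))%R; [apply Rinv_0_lt_compat, Hf|].
    unfold Rdiv in G3. lra.
  (* If both were slow, their Casoratian would vanish at [N]; up to the factorials it is -4 times
     that of numerators and denominators, which is nonzero. *)
  - exfalso.
    assert (H0 := casoratian_growth _ _ _ _ N (fun n Hn => proj2 (HN n Hn))
      (fun n _ => HA n) (fun n _ => HM n) Hslow HMslow N (Nat.le_refl N)).
    cbv beta in H0.
    apply (casoratian_neq_0 (cf_a alpha beta) (cf_b alpha beta gamma) N
      (fun j _ => Hnz j)).
    fold (num alpha beta gamma N) (num alpha beta gamma (S N))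
      (den alpha beta gamma N) (den alpha beta gamma (S N)).
    assert (F1 := fact_sq_neq_0 N). assert (F2 := fact_sq_neq_0 (S N)).
    transitivity (- (1 / 4) * fact_sq N * fact_sq (S N) *
      (num alpha beta gamma N / fact_sq N * (M (S N) / fact_sq (S N)) -
      num alpha beta gamma (S N) / fact_sq (S N) * (M N / fact_sq N))).
    + unfold M. field. split; assumption.
    + rewrite H0. ring.
Qed.
(** * Vanishing partial numerators *)

Lemma admissible_summable (alpha beta gamma : C) :
  admissible alpha beta gamma -> exists s : C, is_series (term alpha beta gamma) s.
Proof.
  intros [Hre [Ha [Hb _]]]. apply Cex_series_abs.
  apply (term_raabe alpha beta gamma Hre Ha Hb).
Qed.

Lemma admissible_sym (alpha beta gamma : C) :
  admissible alpha beta gamma -> admissible beta alpha gamma.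
Proof.
  intros [Hre [Ha [Hb Hg]]]. repeat split; try assumption.
  replace (2 * gamma - beta - alpha) with (2 * gamma - alpha - beta) by ring. exact Hre.
Qed.

Lemma CF_num_ext (a b a' b' : nat -> C) (n : nat) :
  (forall j, a j = a' j) -> (forall j, b j = b' j) -> CF_num a b n = CF_num a' b' n.
Proof.
  intros Ha Hb. enough (H : CF_num a b n = CF_num a' b' n /\
    CF_num a b (S n) = CF_num a' b' (S n)) by apply H.
  induction n as [|n [IH1 IH2]]; [split; [reflexivity|apply Ha]|].
  split; [exact IH2|].
  change (a (S n) * CF_num a b (S n) + b (S n) * CF_num a b n =
    a' (S n) * CF_num a' b' (S n) + b' (S n) * CF_num a' b' n).
  now rewrite IH1, IH2, Ha, Hb.
Qed.

Lemma num_sym (alpha beta gamma : C) (n : nat) :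
  num alpha beta gamma n = num beta alpha gamma n.
Proof.
  apply CF_num_ext; intros j; unfold cf_a, cf_b, fwd_diff; ring.
Qed.

(** A vanishing b_{m+1} cuts the memory of the recurrence: it restarts at m + 1 with A_{m+1} as an
    overall factor. *)
Lemma CF_num_shift (a b : nat -> C) (m n : nat) :
  b (S m) = 0 ->
  CF_num a b (S m + n) =
  CF_num a b (S m) * CF_num (fun j => a (S m + j)%nat) (fun j => b (S m + j)%nat) n.
Proof.
  intros Hb. set (a' := fun j => a (S m + j)%nat). set (b' := fun j => b (S m + j)%nat).
  enough (H : CF_num a b (S m + n) = CF_num a b (S m) * CF_num a' b' n /\
    CF_num a b (S m + S n) = CF_num a b (S m) * CF_num a' b' (S n)) by apply H.
  induction n as [|n [IH1 IH2]].
  - rewrite Nat.add_0_r, Nat.add_1_r. split; [simpl; ring|].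
    change (CF_num a b (S (S m))) with (a (S m) * CF_num a b (S m) + b (S m) * CF_num a b m).
    change (CF_num a' b' 1) with (a (S m + 0)%nat). rewrite Nat.add_0_r, Hb. ring.
  - split; [exact IH2|].
    replace (S m + S (S n))%nat with (S (S (S m + n))) by lia.
    replace (S m + S n)%nat with (S (S m + n)) in IH2 by lia.
    change (CF_num a b (S (S (S m + n)))) with
      (a (S (S m + n)) * CF_num a b (S (S m + n)) + b (S (S m + n)) * CF_num a b (S m + n)).
    change (CF_num a' b' (S (S n))) with
      (a (S m + S n)%nat * CF_num a' b' (S n) + b (S m + S n)%nat * CF_num a' b' n).
    replace (S m + S n)%nat with (S (S m + n)) by lia.
    rewrite IH1, IH2. ring.
Qed.

Lemma INC_add (m n : nat) : INC (m + n) = INC m + INC n.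
Proof. unfold INC. now rewrite plus_INR, RtoC_plus. Qed.

Lemma INC_neq_opp_S (m n : nat) : INC m <> - INC (S n).
Proof.
  unfold INC. rewrite <- RtoC_opp. intros H. apply RtoC_inj in H.
  assert (H1 := pos_INR m). assert (H2 := lt_0_INR (S n) ltac:(lia)). lra.
Qed.

Lemma nonpos_integer_sub (x : C) (m : nat) :
  nonpos_integer (x + INC m) -> nonpos_integer x.
Proof.
  intros [k Hk]. exists (k + m)%nat. rewrite INC_add.
  replace x with (x + INC m - INC m) by ring. rewrite Hk. ring.
Qed.

(** With alpha = -n, moving the index by n exchanges the roles of the factors j and j + alpha,
    whence the new first parameter n. The real part in the convergence condition drops by n. *)
Lemma admissible_shift (alpha beta gamma : C) (n : nat) :
  admissible alpha beta gamma -> alpha = - INC n ->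
  admissible (INC n) (beta + INC n) (gamma + INC n).
Proof.
  intros [Hre [Ha [Hb Hg]]] ->. repeat split.
  - replace (2 * (gamma + INC n) - INC n - (beta + INC n)) with
      (2 * gamma - - INC n - beta - INC n) by ring.
    change (Re (2 * gamma - - INC n - beta) - INR n < 1)%R.
    assert (H := pos_INR n). lra.
  - intros [k Hk].
    apply (INC_neq_opp_S n (2 * k)). rewrite INC_S.
    replace (INC (2 * k)) with (2 * INC k)
      by (unfold INC; rewrite mult_INR, RtoC_mult; reflexivity).
    transitivity (2 * ((INC n + 1) / 2) - 1); [field|]. rewrite Hk. ring.
  - (* [n] is even, since [(1 - n) / 2] is not a nonpositive integer. *)
    destruct (Nat.Even_or_Odd n) as [[m ->]|[m ->]].
    + intros H. apply Hb. apply (nonpos_integer_sub _ m).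
      replace ((beta + 1) / 2 + INC m) with ((beta + INC (2 * m) + 1) / 2); [exact H|].
      replace (INC (2 * m)) with (2 * INC m)
        by (unfold INC; rewrite mult_INR, RtoC_mult; reflexivity).
      field.
    + intros _. apply Ha. exists m. rewrite Nat.add_1_r, INC_S.
      replace (INC (2 * m)) with (2 * INC m)
        by (unfold INC; rewrite mult_INR, RtoC_mult; reflexivity).
      field.
  - intros H. apply Hg. apply (nonpos_integer_sub _ n).
    replace (gamma + 1 + INC n) with (gamma + INC n + 1) by ring. exact H.
Qed.

Lemma cf_b_eq_0 (alpha beta gamma : C) (n : nat) :
  ~ nonpos_integer (gamma + 1) -> cf_b alpha beta gamma (S n) = 0 ->
  alpha = - INC (S n) \/ beta = - INC (S n).
Proof.
  intros Hg H. unfold cf_b in H.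
  destruct (Ceq_dec alpha (- INC (S n))) as [|Ha]; [now left|].
  destruct (Ceq_dec beta (- INC (S n))) as [|Hb]; [now right|exfalso].
  revert H. repeat apply Cmult_neq_0.
  - intros H. apply (f_equal Re) in H. simpl in H. lra.
  - apply INC_S_neq_0.
  - intros H. apply Ha. transitivity (INC (S n) + alpha - INC (S n)); [ring|].
    rewrite H. ring.
  - intros H. apply Hb. transitivity (INC (S n) + beta - INC (S n)); [ring|].
    rewrite H. ring.
  - intros H. apply Hg. exists n. rewrite INC_S in H.
    transitivity (INC n + 1 + gamma - INC n); [ring|]. rewrite H. ring.
Qed.

Lemma weight_eq_0 (alpha beta : C) (m n : nat) :
  alpha = - INC (S m) -> (S m <= n)%nat -> weight alpha beta n = 0.
Proof.
  intros -> Hn. unfold weight.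
  enough (H : pochhammer (- INC (S m) + 1) n = 0) by (rewrite H; ring).
  induction Hn as [|n Hn IH]; cbn [pochhammer].
  - rewrite INC_S. ring.
  - rewrite IH. ring.
Qed.

(** The bound of [remainder_bound] is proportional to |[weight]|, so it gives exact vanishing
    here. *)
Lemma remainder_eq_0 (alpha beta gamma s : C) (n : nat) :
  admissible alpha beta gamma -> is_series (term alpha beta gamma) s ->
  weight alpha beta n = 0 ->
  s * num alpha beta gamma n - 4 * den alpha beta gamma n = 0.
Proof.
  intros [Hre [Ha [Hb _]]] Hs Hw. apply Cmod_eq_0, Rle_antisym; [|apply Cmod_ge_0].
  destruct (remainder_bound alpha beta gamma s Hre Ha Hb Hs) as [T HT].
  specialize (HT n). rewrite Hw, Cmod_0, Rmult_0_r in HT. exact HT.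
Qed.

(** Splits A_n at the first vanishing b_{m+1} into A_{m+1} times a numerator of the shifted
    fraction. *)
Lemma num_neq_0_shift (alpha beta gamma : C) (m : nat) :
  admissible alpha beta gamma -> alpha = - INC (S m) ->
  (forall j, (j < m)%nat -> cf_b alpha beta gamma (S j) <> 0) ->
  eventually (fun n =>
    num (INC (S m)) (beta + INC (S m)) (gamma + INC (S m)) n <> 0) ->
  eventually (fun n => num alpha beta gamma n <> 0).
Proof.
  intros Hadm Hal Hb [N HN].
  assert (Hb0 : cf_b alpha beta gamma (S m) = 0) by (unfold cf_b; rewrite Hal; ring).
  exists (S m + N)%nat. intros n Hn.
  replace n with (S m + (n - S m))%nat by lia.
  unfold num. rewrite CF_num_shift by exact Hb0. apply Cmult_neq_0.
  (* The remainder vanishes at m + 1, so A_{m+1} = 0 would force B_{m+1} = 0 and a zero Casoratian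
     at m. *)
  - intros H0. destruct (admissible_summable _ _ _ Hadm) as [s Hs].
    assert (HM := remainder_eq_0 alpha beta gamma s (S m) Hadm Hs
      (weight_eq_0 alpha beta m (S m) Hal (Nat.le_refl _))).
    unfold num, den in HM. rewrite H0 in HM.
    apply (casoratian_neq_0 (cf_a alpha beta) (cf_b alpha beta gamma) m Hb).
    rewrite H0.
    transitivity (- (1 / 4) * CF_num (cf_a alpha beta) (cf_b alpha beta gamma) m *
      (s * 0 - 4 * CF_den (cf_a alpha beta) (cf_b alpha beta gamma) (S m))).
    + field.
    + rewrite HM. ring.
  - assert (HN' := HN (n - S m)%nat ltac:(lia)). intros H0. apply HN'. rewrite <- H0.
    apply CF_num_ext; intros j; unfold cf_a, cf_b, fwd_diff; rewrite Hal;
      repeat rewrite ?INC_S, ?INC_add; ring.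
Qed.

Lemma num_neq_0_regular (alpha beta gamma : C) :
  admissible alpha beta gamma ->
  (forall n, cf_b alpha beta gamma (S n) <> 0) ->
  eventually (fun n => num alpha beta gamma n <> 0).
Proof.
  intros Hadm Hb. destruct (admissible_summable _ _ _ Hadm) as [s Hs].
  generalize (num_dominates alpha beta gamma s Hadm Hs Hb 1 Rlt_0_1).
  apply filter_imp. intros n Hn H0. rewrite H0, Cmod_0, Rmult_0_r in Hn.
  assert (H := Cmod_ge_0 (s * 0 - 4 * den alpha beta gamma n)). lra.
Qed.

(** At most one b_j vanishes, through beta. A single shift with the parameters exchanged leaves no
    zero: the new ones are m + 1 > 0 and alpha + m + 1, which is a negative integer only if alpha
    is. *)
Lemma num_neq_0_half_regular (alpha beta gamma : C) :
  admissible alpha beta gamma -> (forall n, alpha <> - INC (S n)) ->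
  eventually (fun n => num alpha beta gamma n <> 0).
Proof.
  intros Hadm Ha.
  destruct (Classical_Prop.classic (exists m, beta = - INC (S m))) as [[m Hm]|Hno].
  - generalize (num_neq_0_shift beta alpha gamma m (admissible_sym _ _ _ Hadm) Hm).
    intros H. eapply filter_imp; [|apply H].
    + intros n Hn. rewrite num_sym. exact Hn.
    + intros j Hj H0. apply cf_b_eq_0 in H0; [|apply Hadm]. destruct H0 as [H0|H0].
      * rewrite Hm in H0. apply (f_equal Copp) in H0.
        replace (- - INC (S m)) with (INC (S m)) in H0 by ring.
        replace (- - INC (S j)) with (INC (S j)) in H0 by ring.
        apply RtoC_inj, INR_eq in H0. lia.
      * exact (Ha j H0).
    + apply num_neq_0_regular.
      * apply (admissible_shift beta alpha gamma); [now apply admissible_sym|exact Hm].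
      * intros n H0. apply cf_b_eq_0 in H0.
        -- destruct H0 as [H0|H0]; [exact (INC_neq_opp_S _ _ H0)|].
           apply (Ha (n + S m)%nat).
           transitivity (alpha + INC (S m) - INC (S m)); [ring|].
           rewrite H0. rewrite !INC_S, INC_add, INC_S. ring.
        -- apply (admissible_shift beta alpha gamma); [now apply admissible_sym|exact Hm].
  - apply num_neq_0_regular; [exact Hadm|]. intros n H0.
    apply cf_b_eq_0 in H0; [|apply Hadm]. destruct H0 as [H0|H0].
    + exact (Ha n H0).
    + apply Hno. now exists n.
Qed.

(** Shifting at the earlier zero makes the first parameter positive, which leaves at most one
    further zero. *)
Lemma num_neq_0_ordered (alpha beta gamma : C) (m m' : nat) :
  admissible alpha beta gamma -> alpha = - INC (S m) -> beta = - INC (S m') ->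
  (m <= m')%nat -> eventually (fun n => num alpha beta gamma n <> 0).
Proof.
  intros Hadm Hm Hm' Hle. apply (num_neq_0_shift alpha beta gamma m Hadm Hm).
  - assert (Hinj : forall i j, - INC (S i) = - INC (S j) -> i = j).
    { intros i j H. apply (f_equal Copp) in H.
      replace (- - INC (S i)) with (INC (S i)) in H by ring.
      replace (- - INC (S j)) with (INC (S j)) in H by ring.
      apply RtoC_inj, INR_eq in H. lia. }
    intros j Hj H0. apply cf_b_eq_0 in H0; [|apply Hadm].
    destruct H0 as [H0|H0]; rewrite ?Hm, ?Hm' in H0; apply Hinj in H0; lia.
  - apply num_neq_0_half_regular; [now apply admissible_shift with alpha|].
    intros n. apply INC_neq_opp_S.
Qed.

Lemma num_eventually_neq_0 (alpha beta gamma : C) :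
  admissible alpha beta gamma -> eventually (fun n => num alpha beta gamma n <> 0).
Proof.
  intros Hadm.
  destruct (Classical_Prop.classic (exists m, alpha = - INC (S m))) as [[m Hm]|Ha].
  2: { apply num_neq_0_half_regular; [exact Hadm|]. intros n H. apply Ha. now exists n. }
  assert (Hsym : eventually (fun n => num beta alpha gamma n <> 0) ->
    eventually (fun n => num alpha beta gamma n <> 0)).
  { apply filter_imp. intros n. now rewrite num_sym. }
  destruct (Classical_Prop.classic (exists m, beta = - INC (S m))) as [[m' Hm']|Hb].
  2: { apply Hsym, num_neq_0_half_regular; [now apply admissible_sym|].
       intros n H. apply Hb. now exists n. }
  destruct (Nat.le_ge_cases m m') as [H|H].
  - now apply (num_neq_0_ordered alpha beta gamma m m').
  - apply Hsym. apply (num_neq_0_ordered beta alpha gamma m' m); try assumption.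
    now apply admissible_sym.
Qed.

(** * From the remainder to the value of the continued fraction *)

Lemma remainder_small (alpha beta gamma s : C) :
  admissible alpha beta gamma -> is_series (term alpha beta gamma) s ->
  forall eps : R, (0 < eps)%R -> eventually (fun n =>
    (Cmod (s * num alpha beta gamma n - 4 * den alpha beta gamma n) <
      eps * Cmod (num alpha beta gamma n))%R).
Proof.
  intros Hadm Hs eps Heps.
  assert (Hvanish : forall m, alpha = - INC (S m) \/ beta = - INC (S m) ->
    eventually (fun n => (Cmod (s * num alpha beta gamma n - 4 * den alpha beta gamma n) <
      eps * Cmod (num alpha beta gamma n))%R)).
  { intros m Hm.
    generalize (filter_and _ _ (num_eventually_neq_0 _ _ _ Hadm)
      (ex_intro (fun N => forall n, (N <= n)%nat -> (S m <= n)%nat) (S m) (fun n H => H))).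
    apply filter_imp. intros n [Hn Hmn].
    rewrite (remainder_eq_0 alpha beta gamma s n Hadm Hs).
    - rewrite Cmod_0. apply Rmult_lt_0_compat; [exact Heps|]. now apply Cmod_gt_0.
    - destruct Hm as [Hm|Hm]; [now apply weight_eq_0 with m|].
      transitivity (weight beta alpha n); [apply Cmult_comm|now apply weight_eq_0 with m]. }
  destruct (Classical_Prop.classic
    (exists m, alpha = - INC (S m) \/ beta = - INC (S m))) as [[m Hm]|Hno].
  - exact (Hvanish m Hm).
  - apply num_dominates; try assumption. intros n H0.
    apply cf_b_eq_0 in H0; [|apply Hadm]. apply Hno. now exists n.
Qed.

(** The hypotheses say that B_n / A_n tends to s/4. Inverting on the sphere splits into s = 0, with
    limit infinity, and s nonzero. *)
Lemma is_CF_of_remainder (a b : nat -> C) (s : C) :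
  eventually (fun n => CF_num a b n <> 0) ->
  (forall eps : R, (0 < eps)%R -> eventually (fun n =>
    (Cmod (s * CF_num a b n - 4 * CF_den a b n) < eps * Cmod (CF_num a b n))%R)) ->
  is_CF a b (Cbar_div 4 s).
Proof.
  intros Hnum Hsmall. split.
  { revert Hnum. apply filter_imp. intros n Hn. now left. }
  unfold Cbar_div at 2. destruct (Ceq_dec s 0) as [->|Hs0].
  - intros P [Pinf [M HM]].
    assert (HM0 := Rabs_pos M). assert (HM1 := Rle_abs M).
    (* With this tolerance |A_n / B_n| > |M| + 1 whenever B_n is nonzero; otherwise the convergent
       is infinity itself. *)
    assert (He : (0 < 4 / (Rabs M + 1))%R) by (apply Rdiv_lt_0_compat; lra).
    generalize (filter_and _ _ Hnum (Hsmall _ He)). unfold filtermap.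
    apply filter_imp. intros n [Hn H]. unfold Cbar_div.
    destruct (Ceq_dec (CF_den a b n) 0) as [Hd|Hd]; [exact Pinf|]. apply HM.
    rewrite Cmod_div by exact Hd.
    replace (0 * CF_num a b n - 4 * CF_den a b n) with (- (4 * CF_den a b n)) in H by ring.
    rewrite Cmod_opp, Cmod_mult, Cmod_R, Rabs_pos_eq in H by lra.
    assert (Hd' := proj1 (Cmod_gt_0 _) Hd).
    set (x := Cmod (CF_num a b n)) in *. set (y := Cmod (CF_den a b n)) in *.
    apply Rmult_lt_reg_r with y; [exact Hd'|].
    replace (x / y * y)%R with x by (field; lra).
    apply (Rmult_lt_compat_l (Rabs M + 1)) in H; [|lra].
    replace ((Rabs M + 1) * (4 / (Rabs M + 1) * x))%R with (4 * x)%R in H by (field; lra).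
    nra.
  - assert (Hs := proj1 (Cmod_gt_0 _) Hs0). set (r := Cmod s) in *.
    (* Tolerance r/2 gives r |A_n| < (r/2) |A_n| + 4 |B_n|. *)
    assert (Hden : eventually (fun n => CF_den a b n <> 0 /\
      (r * Cmod (CF_num a b n) <= 8 * Cmod (CF_den a b n))%R)).
    { generalize (filter_and _ _ Hnum (Hsmall (r / 2)%R ltac:(lra))). apply filter_imp.
      intros n [Hn H].
      assert (Ht := Cmod_triangle (s * CF_num a b n - 4 * CF_den a b n) (4 * CF_den a b n)).
      replace (s * CF_num a b n - 4 * CF_den a b n + 4 * CF_den a b n)
        with (s * CF_num a b n) in Ht by ring.
      rewrite !Cmod_mult, (Cmod_R 4), Rabs_pos_eq in Ht by lra. fold r in Ht.
      assert (Hx := proj1 (Cmod_gt_0 _) Hn). split; [|lra].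
      intros Hd. rewrite Hd, Cmod_0 in Ht. rewrite Hd in H. nra. }
    assert (Hlim : filterlim (fun n => CF_num a b n / CF_den a b n) eventually
      (locally (T := C_UniformSpace) (4 / s))).
    { apply Cfilterlim_Cmod. intros eps Heps.
      (* The error is |s A_n - 4 B_n| / (r |B_n|); with |A_n| <= 8 |B_n| / r this tolerance makes it
         less than eps/2. *)
      assert (He : (0 < eps * (r * r) / 16)%R)
        by (apply Rdiv_lt_0_compat; [repeat apply Rmult_lt_0_compat|]; lra).
      generalize (filter_and _ _ Hnum (filter_and _ _ Hden (Hsmall _ He))). apply filter_imp.
      intros n [Hn [[Hd Hle] H]].
      replace (CF_num a b n / CF_den a b n - 4 / s) with
        ((s * CF_num a b n - 4 * CF_den a b n) / (s * CF_den a b n))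
        by (field; split; assumption).
      rewrite Cmod_div by (now apply Cmult_neq_0). rewrite (Cmod_mult s). fold r.
      assert (Hd' := proj1 (Cmod_gt_0 _) Hd). assert (Hn' := proj1 (Cmod_gt_0 _) Hn).
      set (x := Cmod (CF_num a b n)) in *. set (y := Cmod (CF_den a b n)) in *.
      assert (Hry : (0 < r * y)%R) by nra.
      apply Rmult_lt_reg_r with (r * y)%R; [exact Hry|].
      unfold Rdiv at 1. rewrite Rmult_assoc, Rinv_l, Rmult_1_r by lra.
      apply Rlt_trans with (1 := H).
      apply Rle_lt_trans with (eps * r / 16 * (8 * y))%R.
      - replace (eps * (r * r) / 16 * x)%R with (eps * r / 16 * (r * x))%R by field.
        apply Rmult_le_compat_l; [|exact Hle]. apply Rlt_le, Rdiv_lt_0_compat; nra.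
      - assert (0 < eps * (r * y))%R by nra. lra. }
    intros P HP. specialize (Hlim _ HP). revert Hlim. unfold filtermap. intros Hlim.
    generalize (filter_and _ _ Hden Hlim). apply filter_imp. intros n [[Hd _] H].
    unfold Cbar_div. destruct (Ceq_dec (CF_den a b n) 0) as [Hd'|_]; [contradiction|exact H].
Qed.

Theorem theorem2p1 (alpha beta gamma : C)
  (Hre : (Re (2 * gamma - alpha - beta) < 1)%R)
  (Halpha : ~ nonpos_integer ((alpha + 1) / 2))
  (Hbeta : ~ nonpos_integer ((beta + 1) / 2))
  (Hgamma : ~ nonpos_integer (gamma + 1)) :
  exists S : C,
    is_series
      (fun n : nat =>
         pochhammer (1 / 2) n * pochhammer (gamma + 1) n /
         (pochhammer ((alpha + 1) / 2) (n + 1) *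
          pochhammer ((beta + 1) / 2) (n + 1))) S /\
    is_CF
      (fwd_diff (fun n : nat => INC n * (INC n + alpha) * (INC n + beta)))
      (fun n : nat =>
         - 2 * INC n * (INC n + alpha) * (INC n + beta) * (INC n + gamma))
      (Cbar_div 4 S).
Proof.
  assert (Hadm : admissible alpha beta gamma) by (repeat split; assumption).
  destruct (admissible_summable _ _ _ Hadm) as [s Hs].
  exists s. split; [exact Hs|].
  change (is_CF (cf_a alpha beta) (cf_b alpha beta gamma) (Cbar_div 4 s)).
  apply is_CF_of_remainder.
  - exact (num_eventually_neq_0 _ _ _ Hadm).
  - exact (remainder_small _ _ _ _ Hadm Hs).
Qed.
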